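(* Let $n\ge3$, $m\ge1$, and fix a dimension vector $\mathbf e\in\mathbb{N}^2$ of $K(n)$. For each $V\in\mathrm{Gr}(\mathcal{H}_m)$ the quiver Grassmannian $\mathrm{Gr}_{\mathbf e}(P_{m+1}^V)$ is smooth. Moreover, for $V,W\in\mathrm{Gr}(\mathcal{H}_m)$ with $\dim V=\dim W$ one has $\mathrm{Gr}_{\mathbf e}(P_{m+1}^V)\cong\mathrm{Gr}_{\mathbf e}(P_{m+1}^W)$.
   Context: All representations are finite-dimensional over $\mathbb{C}$. $K(n)$ is the quiver with vertices $1,2$ and $n$ arrows from $2$ to $1$; dimension vectors are written (dimension at $1$, dimension at $2$). Let $u_0=0$, $u_1=1$, $u_{k+1}=nu_k-u_{k-1}$. For $m\ge1$, $P_m$ is the unique (up to isomorphism) indecomposable representation of $K(n)$ of dimension vector $(u_m,u_{m-1})$ with $\operatorname{Ext}^1(P_m,P_m)=0$ (indecomposable preprojective). $\mathcal{H}_m=\operatorname{Hom}(P_m,P_{m+1})$ is $n$-dimensional; $\mathrm{Gr}(\mathcal{H}_m)$ is the set of subspaces $V$ of $\mathcal{H}_m$ with $0\ne V\ne\mathcal{H}_m$. For such $V$ the evaluation map $ev_V:P_m\otimes V\to P_{m+1}$ is injective and $P_{m+1}^V:=\operatorname{coker}(ev_V)$ (truncated preprojective). $\mathrm{Gr}_{\mathbf e}(X)$ is the projective variety of subrepresentations of $X$ of dimension vector $\mathbf e$. *)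

(* Defs.v *)
From HB Require Import structures.
From mathcomp Require Import all_boot all_order all_algebra.
From mathcomp Require Import complex mpoly.
From mathcomp Require Import reals.

Set Implicit Arguments.
Unset Strict Implicit.
Unset Printing Implicit Defensive.

Import GRing.Theory.
Local Open Scope ring_scope.

(** * Representations of the Kronecker quiver K(n)

  Vectors are row vectors: the arrow [arr M a] from vertex 2 to vertex 1 acts
  by [x |-> x *m arr M a], and a linear map [f] acts by [x |-> x *m f]. *)

Record krep (F : fieldType) (n : nat) := KRep {
  dim1 : nat;
  dim2 : nat;
  arr : 'I_n -> 'M[F]_(dim2, dim1)
}.

Section Representations.
Variables (F : fieldType) (n : nat).
Implicit Types M N E Q : krep F n.

Definition vmaps M N : Type :=
  ('M[F]_(dim1 M, dim1 N) * 'M[F]_(dim2 M, dim2 N))%type.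

Definition intertwine M N (a : 'I_n) (f : vmaps M N) : 'M[F]_(dim2 M, dim1 N) :=
  arr M a *m f.1 - f.2 *m arr N a.

Fact intertwine_is_linear M N a : linear (@intertwine M N a).
Proof.
move=> c f g; rewrite /intertwine /= mulmxDr mulmxDl -scalemxAr -scalemxAl.
by rewrite scalerBr opprD addrACA.
Qed.

HB.instance Definition _ M N a := GRing.isLinear.Build F (vmaps M N)
  'M[F]_(dim2 M, dim1 N) *:%R (@intertwine M N a) (@intertwine_is_linear M N a).

Definition khom M N : {vspace vmaps M N} :=
  (\bigcap_(a < n) lker (linfun (@intertwine M N a)))%VS.

Lemma mem_khom M N (f : vmaps M N) :
  reflect (forall a, arr M a *m f.1 = f.2 *m arr N a) (f \in khom M N).
Proof.
rewrite /khom memvE; apply: (iffP subv_bigcapP) => [fH a | fH a _].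
  move: (fH a isT); rewrite -memvE memv_ker lfunE /= subr_eq0.
  by move/eqP.
by rewrite -memvE memv_ker lfunE /= subr_eq0 fH.
Qed.

Definition kiso M N : Prop :=
  exists f : vmaps M N, exists g : vmaps N M,
    [/\ f \in khom M N, g \in khom N M,
        f.1 *m g.1 = 1%:M /\ g.1 *m f.1 = 1%:M
      & f.2 *m g.2 = 1%:M /\ g.2 *m f.2 = 1%:M].

Definition kzero M : Prop := dim1 M = 0%N /\ dim2 M = 0%N.

Definition dsum M N : krep F n :=
  KRep (fun a => block_mx (arr M a) 0 0 (arr N a)).

Definition indecomposable M : Prop :=
  ~ kzero M /\ forall A B, kiso M (dsum A B) -> kzero A \/ kzero B.

(* [M -f-> N -p-> Q -> 0] is exact, i.e. [p] exhibits [Q] as coker f *)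
Definition is_coker M N Q (f : vmaps M N) (p : vmaps N Q) : Prop :=
  [/\ p \in khom N Q, row_full p.1, row_full p.2,
      (kermx p.1 == f.1)%MS & (kermx p.2 == f.2)%MS].

Definition short_exact N E M (i : vmaps N E) (p : vmaps E M) : Prop :=
  [/\ i \in khom N E, row_free i.1, row_free i.2 & is_coker i p].

(* Ext^1(M, N) = 0 in the sense of Yoneda: all extensions of M by N split *)
Definition Ext1_zero M N : Prop :=
  forall E (i : vmaps N E) (p : vmaps E M), short_exact i p ->
    exists s : vmaps M E,
      [/\ s \in khom M E, s.1 *m p.1 = 1%:M & s.2 *m p.2 = 1%:M].

Fixpoint useq (k : nat) : int :=
  if k is k'.+1 then
    if k' is k''.+1 then n%:Z * useq k' - useq k'' else 1
  else 0.

(* [P] is (a representative of the isomorphism class) P_m, for [m >= 1] *)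
Definition preprojective (m : nat) (P : krep F n) : Prop :=
  [/\ (dim1 P)%:Z = useq m, (dim2 P)%:Z = useq m.-1,
      indecomposable P & Ext1_zero P P].

Definition proper_subspace M N (V : {vspace vmaps M N}) : Prop :=
  [/\ (V <= khom M N)%VS, V != 0%VS & V != khom M N].

(* M (x) V, identified with the direct sum of \dim V copies of M by means of
   the basis [vbasis V] of V *)
Definition tensor M N (V : {vspace vmaps M N}) : krep F n :=
  KRep (fun a => \mxblock_(i < \dim V, j < \dim V)
                   (if i == j then arr M a else 0)).

(* sum_i x_i (x) v_i |-> sum_i v_i(x_i), where v_i = tnth (vbasis V) i *)
Definition ev M N (V : {vspace vmaps M N}) : vmaps (tensor V) N :=
  (\mxcol_(i < \dim V) (tnth (vbasis V) i).1,
   \mxcol_(i < \dim V) (tnth (vbasis V) i).2).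

(* With M = P_m and N = P_{m+1}: [Q] is (a model of) P_{m+1}^V *)
Definition truncated M N (V : {vspace vmaps M N}) Q : Prop :=
  exists p : vmaps N Q, is_coker (ev V) p.

End Representations.

(** * Quasi-projective varieties in the classical sense

  A set of points together with an embedding into P^(ncoord - 1), given by
  homogeneous coordinates of each point (only their class up to a nonzero
  scalar matters below). That [hcoord] is nowhere zero, injective up to scalars
  and has locally closed image is not part of the record; for [quiverGr] it is
  the classical property of the Plucker and Segre embeddings. *)

Record projvar (F : fieldType) := ProjVar {
  point :> Type;
  ncoord : nat;
  hcoord : point -> 'I_ncoord -> F
}.

Section Varieties.
Variable F : fieldType.
Implicit Types X Y : projvar F.

Definition homogeneous (N : nat) (p : {mpoly F[N]}) : Prop :=
  exists d : nat, p \is d.-homog.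

Definition zopen X (O : X -> Prop) : Prop :=
  exists S : {mpoly F[ncoord X]} -> Prop,
    (forall p, S p -> homogeneous p) /\
    (forall x, O x <-> exists p, S p /\ p.@[hcoord x] != 0).

(* [phi] is regular on the open set [O]: locally a quotient of two homogeneous
   polynomials of the same degree; values outside [O] are irrelevant *)
Definition regular_on X (O : X -> Prop) (phi : X -> F) : Prop :=
  forall x, O x ->
    exists (W : X -> Prop) (d : nat) (g h : {mpoly F[ncoord X]}),
      [/\ zopen W /\ W x, (forall y, W y -> O y),
          g \is d.-homog /\ h \is d.-homog
        & forall y, W y -> h.@[hcoord y] != 0 /\
                           phi y = g.@[hcoord y] / h.@[hcoord y]].

Definition var_morphism X Y (f : X -> Y) : Prop :=
  (forall O : Y -> Prop, zopen O -> zopen (fun x => O (f x))) /\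
  (forall (O : Y -> Prop) (phi : Y -> F), zopen O -> regular_on O phi ->
     regular_on (fun x => O (f x)) (fun x => phi (f x))).

Definition var_iso X Y : Prop :=
  exists (f : X -> Y) (g : Y -> X),
    [/\ var_morphism f, var_morphism g, cancel f g & cancel g f].

(* Jacobian definition of smoothness: in a principal open neighbourhood
   {h != 0} of x in projective space, X is the zero locus of c homogeneous
   polynomials whose Jacobian matrix at x has rank c. As these polynomials
   vanish at x, Euler's relation makes this the same as the condition
   for their dehomogenizations in any affine chart around x. *)
Definition smooth_at X (x : X) : Prop :=
  exists (c : nat) (f : 'I_c -> {mpoly F[ncoord X]}) (h : {mpoly F[ncoord X]}),
    [/\ (forall i, homogeneous (f i)),
        homogeneous h /\ h.@[hcoord x] != 0,
        (forall z : 'I_(ncoord X) -> F,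
           (exists j, z j != 0) -> h.@[z] != 0 ->
           ((forall i, (f i).@[z] = 0) <->
            (exists y : X, exists2 a : F, a != 0 &
               forall j, z j = a * hcoord y j)))
      & \rank (\matrix_(i < c, j < ncoord X) ((f i)^`M(j)).@[hcoord x]) = c].

Definition smooth X : Prop := forall x : X, smooth_at x.

End Varieties.

(** * Quiver Grassmannians *)

Section QuiverGrassmannian.
Variables (F : fieldType) (n : nat).

Definition subrep_pred (e : nat * nat) (X : krep F n)
    (U : {vspace 'rV[F]_(dim1 X)} * {vspace 'rV[F]_(dim2 X)}) : bool :=
  [&& \dim U.1 == e.1, \dim U.2 == e.2
    & [forall a, (linfun (mulmxr (arr X a)) @: U.2 <= U.1)%VS]].

(* Plucker coordinates of U, dim U = k, with respect to [vbasis U]; they are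
   indexed by all k-tuples of columns, hence alternating in the tuple *)
Definition plucker (k d : nat) (U : {vspace 'rV[F]_d})
    (I : {ffun 'I_k -> 'I_d}) : F :=
  \det (\matrix_(i < k, j < k) ((vbasis U)`_i) 0 (I j)).

Definition coord_index (e : nat * nat) (X : krep F n) : finType :=
  ({ffun 'I_e.1 -> 'I_(dim1 X)} * {ffun 'I_e.2 -> 'I_(dim2 X)})%type.

(* Gr_e(X) inside Gr(e_1, X_1) x Gr(e_2, X_2), embedded into projective space
   by the two Plucker embeddings followed by the Segre embedding *)
Definition quiverGr (e : nat * nat) (X : krep F n) : projvar F :=
  @ProjVar F {U | subrep_pred e (X := X) U} #|coord_index e X|
    (fun U k => let IJ := @enum_val (coord_index e X) predT k in
       plucker (val U).1 IJ.1 * plucker (val U).2 IJ.2).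

End QuiverGrassmannian.

(* Main.v *)
From HB Require Import structures.
Require Import Defs.
From mathcomp Require Import all_boot all_order all_algebra perm.
From mathcomp Require Import complex mpoly reals zify ring.

Set Implicit Arguments.
Unset Strict Implicit.
Unset Printing Implicit Defensive.

Import GRing.Theory.

(** Reflection functors reduce P_{m+1}^V to the case m = 1. An endomorphism ring
  of dimension 1 (forced by Ext^1(P, P) = 0 and the Euler form) is inherited by
  reflections, so P_m and P_{m+1} are reflections of P_{m-1} and P_m, and
  right exactness of R^- shows that P_{m+1}^V is the (m-1)-fold reflection of a
  representation of dimension vector (n - dim V, 1) whose arrows span.

  Smoothness: the tangent map of the equations of Gr_e(Q) at U is the
  differential Hom(U_1, Q_1/U_1) + Hom(U_2, Q_2/U_2) -> Hom(U_2, Q_1/U_1)^n, whose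
  cokernel is Ext^1(U, Q/U). For a proper subrepresentation U already
  Ext^1(U, Q) = 0: reflecting U down into dimension vector (n - dim V, 1), it ends
  as a proper subrepresentation there, which has no component at vertex 2.

  Isomorphism: GL_n acts on the arrows, it permutes transitively the
  representations of dimension vector (n - d, 1) with spanning arrows, it is
  compatible with reflections, and it does not change the subrepresentations. *)

(** * Full and free matrices as surjections and injections *)

Section LinearAlgebra.
Local Open Scope ring_scope.
Variable F : fieldType.

Lemma row_full_cancel k l r (p : 'M[F]_(k, l)) (A B : 'M_(l, r)) :
  row_full p -> p *m A = p *m B -> A = B.
Proof.
by move=> /row_fullP[s sp] pAB; rewrite -[A]mul1mx -[B]mul1mx -sp -!mulmxA pAB.
Qed.

Lemma row_full_lift k l r (p : 'M[F]_(k, l)) (z : 'M_(r, l)) :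
  row_full p -> exists x, z = x *m p.
Proof. by move=> pf; apply/submxP; apply: submx_full. Qed.

Lemma row_free_extend k l r (A : 'M[F]_(k, l)) (f : 'M_(k, r)) :
  row_free A -> exists g, A *m g = f.
Proof. by move=> /row_freeP[B AB]; exists (B *m f); rewrite mulmxA AB mul1mx. Qed.

Lemma row_freeW k l (A : 'M[F]_(k, l)) :
  (forall r (x : 'M_(r, k)), x *m A = 0 -> x = 0) -> row_free A.
Proof. by move=> inj; rewrite -kermx_eq0; apply/eqP/inj/mulmx_ker. Qed.

Lemma row_free_inj0 k l r (A : 'M[F]_(k, l)) (x : 'M_(r, k)) :
  row_free A -> x *m A = 0 -> x = 0.
Proof. by move=> /row_freeP[B AB] xA; rewrite -[x]mulmx1 -AB mulmxA xA mul0mx. Qed.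

Lemma row_full_factor k l r (p : 'M[F]_(k, l)) (u : 'M_(k, r)) :
  row_full p -> kermx p *m u = 0 -> exists f, u = p *m f.
Proof.
move=> /row_fullP[s sp] ku; exists (s *m u); apply/eqP.
rewrite mulmxA -subr_eq0 -{1}[u]mul1mx -mulmxBl.
have /submxP[x ->] : (1%:M - p *m s <= kermx p)%MS.
  by apply/sub_kermxP; rewrite mulmxBl mul1mx -mulmxA sp mulmx1 subrr.
by rewrite -mulmxA ku mulmx0.
Qed.

Lemma mul_mxrow_eq0 n k d r (y : 'M[F]_(r, k)) (A : 'I_n -> 'M_(k, d)) :
  y *m (\mxrow_a A a) = 0 <-> forall a, y *m A a = 0.
Proof.
rewrite mul_mxrow; split=> [y0 a | y0].
  by have := congr1 (fun B => submxrow B a) y0; rewrite mxrowK submxrow0.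
by rewrite -[RHS](@mxrow0 _ _ (fun=> d)); apply/eq_mxrowP.
Qed.

End LinearAlgebra.

(** * The reflection functors R^+ and R^-, described by short exact sequences *)

Section Reflections.
Local Open Scope ring_scope.
Variables (F : fieldType) (n : nat).
Implicit Types M N P Q U L : krep F n.

(** Surjectivity of M_2^n -> M_1. Test matrices with any number of rows allow a whole matrix to be
    lifted at once; injectivity and exactness below are phrased likewise. *)
Definition arrows_span M : Prop :=
  forall k (z : 'M[F]_(k, dim1 M)),
    exists x : 'I_n -> 'M_(k, dim2 M), z = \sum_a x a *m arr M a.

Definition arrows_joint_inj M : Prop :=
  forall k (y : 'M[F]_(k, dim2 M)), (forall a, y *m arr M a = 0) -> y = 0.

(* Ext^1(M, N) as the cokernel of
   Hom(M_1, N_1) (+) Hom(M_2, N_2) -> Hom(M_2, N_1)^n *)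
Definition cocycles_trivial M N : Prop :=
  forall eta : 'I_n -> 'M[F]_(dim2 M, dim1 N),
    exists f : vmaps M N, forall a, eta a = intertwine a f.

(* M is the reflection R^- N, i.e. 0 -> N_2 -> N_1^n -> M_1 -> 0 is exact, the
   second map being given by [c], and M_2 is identified with N_1 by [th]. *)
Record is_reflection M N (c : 'I_n -> 'M[F]_(dim1 N, dim1 M))
    (th : 'M[F]_(dim2 M, dim1 N)) (thi : 'M[F]_(dim1 N, dim2 M)) : Prop :=
  IsReflection {
    refl_thK : th *m thi = 1%:M;
    refl_thiK : thi *m th = 1%:M;
    refl_arr : forall a, arr M a = th *m c a;
    refl_complex : \sum_a arr N a *m c a = 0;
    refl_exact : forall k (x : 'I_n -> 'M[F]_(k, dim1 N)),
      \sum_a x a *m c a = 0 -> exists y, forall a, x a = y *m arr N a;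
    refl_surj : forall k (z : 'M[F]_(k, dim1 M)),
      exists x : 'I_n -> 'M_(k, dim1 N), z = \sum_a x a *m c a;
    refl_inj : arrows_joint_inj N }.

Definition reflection M N : Prop :=
  exists c th thi, @is_reflection M N c th thi.

Lemma row_full_mxcolP k d r (c : 'I_n -> 'M[F]_(d, r)) (z : 'M_(k, r)) :
  row_full (\mxcol_a c a) ->
  exists x : 'I_n -> 'M_(k, d), z = \sum_a x a *m c a.
Proof.
move=> /(row_full_lift z)[x zx]; exists (fun a => submxrow x a).
by rewrite zx -{1}[x]submxrowK mul_mxrow_mxcol.
Qed.

Lemma row_full_mxcolW d r (c : 'I_n -> 'M[F]_(d, r)) :
  (forall z : 'M_(r, r), exists x : 'I_n -> 'M_(r, d), z = \sum_a x a *m c a) ->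
  row_full (\mxcol_a c a).
Proof.
move=> /(_ 1%:M)[x x1]; apply/row_fullP; exists (\mxrow_a x a).
by rewrite mul_mxrow_mxcol -x1.
Qed.

Lemma mxcol_ker_exact d r (c : 'I_n -> 'M[F]_(d, r)) k
    (x : 'I_n -> 'M_(k, d)) :
  \sum_a x a *m c a = 0 ->
  exists y, forall a,
    x a = y *m submxrow (row_base (kermx (\mxcol_b c b))) a.
Proof.
move=> xc; have /submxP[y xy] : (\mxrow_a x a <= row_base (kermx (\mxcol_b c b)))%MS.
  by rewrite eq_row_base; apply/sub_kermxP; rewrite mul_mxrow_mxcol.
exists y => a; have := congr1 (fun B => submxrow B a) xy.
by rewrite mxrowK -mul_submxrow.
Qed.

Lemma mxcol_ker_complex d r (c : 'I_n -> 'M[F]_(d, r)) :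
  \sum_a submxrow (row_base (kermx (\mxcol_b c b))) a *m c a = 0.
Proof.
rewrite -mul_mxrow_mxcol submxrowK; apply/sub_kermxP.
by rewrite eq_row_base.
Qed.

Lemma mxcol_ker_inj d r (c : 'I_n -> 'M[F]_(d, r)) k y :
  (forall a, y *m submxrow (row_base (kermx (\mxcol_b c b))) a = 0 :> 'M_(k, _)) ->
  y = 0.
Proof.
move=> y0; have := row_base_free (kermx (\mxcol_b c b)).
move=> /row_free_inj0; apply; rewrite -[X in y *m X]submxrowK.
exact/mul_mxrow_eq0.
Qed.

(** For [c = arr M] this is R^+ M: the kernel of M_2^n -> M_1, with the components of its inclusion
    as arrows. *)
Definition kernel_rep M r (c : 'I_n -> 'M[F]_(dim2 M, r)) : krep F n :=
  KRep (fun a => submxrow (row_base (kermx (\mxcol_b c b))) a).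

Lemma reflection_kernel M : arrows_span M -> reflection M (kernel_rep (arr M)).
Proof.
move=> sM; exists (arr M), 1%:M, 1%:M; split=> //=.
- exact: mulmx1.
- exact: mulmx1.
- by move=> a; rewrite mul1mx.
- exact: mxcol_ker_complex.
- by move=> k x; apply: mxcol_ker_exact.
- by move=> k y; apply: mxcol_ker_inj.
Qed.

Section ReflectionTheory.
Variables (M N : krep F n) (c : 'I_n -> 'M[F]_(dim1 N, dim1 M)).
Variables (th : 'M[F]_(dim2 M, dim1 N)) (thi : 'M[F]_(dim1 N, dim2 M)).
Hypothesis rMN : is_reflection c th thi.

Lemma refl_arrI a : c a = thi *m arr M a.
Proof. by rewrite (refl_arr rMN) mulmxA (refl_thiK rMN) mul1mx. Qed.

Lemma refl_full : row_full (\mxcol_a c a).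
Proof. by apply: row_full_mxcolW => z; apply: (refl_surj rMN). Qed.

(** The universal property of M_1 as the cokernel of N_2 -> N_1^n. *)
Lemma refl_factor k (u : 'I_n -> 'M[F]_(dim1 N, k)) :
  \sum_a arr N a *m u a = 0 -> exists f, forall a, u a = c a *m f.
Proof.
move=> u0; have [|f uf] := @row_full_factor _ _ _ _ _ (\mxcol_a u a) refl_full.
  have := mulmx_ker (\mxcol_a c a).
  set K := kermx _ => K0.
  have [] := @refl_exact _ _ _ _ _ rMN _ (fun a => submxrow K a).
    by rewrite -mul_mxrow_mxcol submxrowK.
  move=> y Ky; rewrite -[K]submxrowK mul_mxrow_mxcol.
  transitivity (\sum_a y *m (arr N a *m u a)).
    by apply: eq_bigr => a _; rewrite Ky -mulmxA.
  by rewrite -mulmx_sumr u0 mulmx0.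
exists f => a; have := congr1 (fun B => submxcol B a) uf.
by rewrite mxcol_mul !mxcolK.
Qed.

Lemma refl_cancel k (f g : 'M[F]_(dim1 M, k)) :
  (forall a, c a *m f = c a *m g) -> f = g.
Proof.
by move=> fg; apply: (row_full_cancel refl_full); rewrite !mxcol_mul; apply/eq_mxcolP.
Qed.

Lemma refl_span : arrows_span M.
Proof.
move=> k z; have [x ->] := refl_surj rMN z; exists (fun a => x a *m thi).
by apply: eq_bigr => a _; rewrite -mulmxA refl_arrI.
Qed.

Lemma refl_dim : (dim2 N + dim1 M = n * dim1 N)%N /\ dim2 M = dim1 N.
Proof.
split; last first.
  apply/eqP; rewrite eqn_leq.
  have fr : row_free th by apply/row_freeP; exists thi; exact: refl_thK rMN.
  have fri : row_free thi by apply/row_freeP; exists th; exact: refl_thiK rMN.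
  move: (rank_leq_col th) (rank_leq_col thi).
  by rewrite (eqP fr) (eqP fri) => -> ->.
have fr : row_free (\mxrow_a arr N a).
  apply: row_freeW => r x /mul_mxrow_eq0; exact: (refl_inj rMN).
have -> : dim2 N = \rank (kermx (\mxcol_a c a)).
  rewrite -{1}(eqP fr); apply/eqP; rewrite eqn_leq !mxrankS //.
    set K := kermx _.
    have [] := @refl_exact _ _ _ _ _ rMN _ (fun a => submxrow K a).
      by rewrite -mul_mxrow_mxcol submxrowK mulmx_ker.
    move=> y Ky; apply/submxP; exists y; rewrite mul_mxrow -[K]submxrowK.
    exact/eq_mxrowP.
  by apply/sub_kermxP; rewrite mul_mxrow_mxcol (refl_complex rMN).
have := refl_full; rewrite /row_full mxrank_ker => /eqP rc.
have le := rank_leq_row (\mxcol_a c a); rewrite rc in le *.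
by rewrite subnK // sum_nat_const card_ord.
Qed.

End ReflectionTheory.

(* Lift [eta] along N'_1^n ->> M'_1 and pair it with the arrows of N. *)
Lemma reflection_cocycles M N M' N' :
  reflection M N -> reflection M' N' ->
  cocycles_trivial N N' -> cocycles_trivial M M'.
Proof.
move=> [c [th [thi rM]]] [c' [th' [thi' rM']]] ext eta.
have /fin_all_exists[l etaE] a := refl_surj rM' (thi *m eta a).
have [g gE] := ext (fun b => \sum_a arr N a *m l a b).
(* By the choice of [g], pairing this family with the arrows of N leaves only [- g.2] times the
   vanishing composite N'_2 -> N'_1^n -> M'_1, so the family factors through M_1. *)
have [|f1 f1E] := @refl_factor _ _ _ _ _ rM _ (fun a => thi *m eta a - g.1 *m c' a).
  under eq_bigr do rewrite etaE mulmxBr mulmx_sumr mulmxA.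
  rewrite sumrB exchange_big /=.
  under eq_bigr do (under eq_bigr do rewrite mulmxA); rewrite -sumrB.
  transitivity (- (g.2 *m \sum_b arr N' b *m c' b)).
    rewrite mulmx_sumr -sumrN; apply: eq_bigr => b _.
    rewrite -!mulmx_suml -mulmxBl gE /intertwine.
    by rewrite addrAC subrr add0r mulNmx mulmxA.
  by rewrite (refl_complex rM') mulmx0 oppr0.
exists (f1, - (th *m g.1 *m thi')) => a; rewrite /intertwine /= mulNmx opprK.
rewrite (refl_arr rM) -mulmxA -f1E mulmxBr mulmxA (refl_thK rM) mul1mx.
by rewrite -[X in _ = _ + X]mulmxA -(refl_arrI rM') !mulmxA subrK.
Qed.

(** Functoriality of R^+: [g.1] is [f.2] read through the identifications [th] and [th'], and [g.2]
    is the map induced on kernels. *)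
Lemma reflection_hom_down M N c th thi M' N' c' th' thi' (f : vmaps M M') :
  @is_reflection M N c th thi -> @is_reflection M' N' c' th' thi' ->
  f \in khom M M' ->
  exists2 g, g \in khom N N' &
    th *m g.1 = f.2 *m th' /\ forall a, g.1 *m c' a = c a *m f.1.
Proof.
move=> rM rM' /mem_khom fH.
have gc a : thi *m f.2 *m th' *m c' a = c a *m f.1.
  by rewrite -mulmxA -(refl_arr rM') -mulmxA -fH mulmxA -(refl_arrI rM).
have [|g2 g2E] := @refl_exact _ _ _ _ _ rM' _
   (fun a => arr N a *m (thi *m f.2 *m th')).
  under eq_bigr do rewrite -mulmxA gc mulmxA.
  by rewrite -mulmx_suml (refl_complex rM) mul0mx.
exists (thi *m f.2 *m th', g2); first by apply/mem_khom => a; rewrite -g2E.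
by rewrite !mulmxA (refl_thK rM) mul1mx; split.
Qed.

(** Functoriality of R^-: [f.2] is [g.1] read through the identifications, and [f.1] is the map
    induced on cokernels. *)
Lemma reflection_hom_up M N c th thi M' N' c' th' thi' (g : vmaps N N') :
  @is_reflection M N c th thi -> @is_reflection M' N' c' th' thi' ->
  g \in khom N N' ->
  exists2 f, f \in khom M M' & th *m g.1 = f.2 *m th'.
Proof.
move=> rM rM' /mem_khom gH.
have [|f1 f1E] := @refl_factor _ _ _ _ _ rM _ (fun a => g.1 *m c' a).
  under eq_bigr do rewrite mulmxA gH -mulmxA.
  by rewrite -mulmx_sumr (refl_complex rM') mulmx0.
exists (f1, th *m g.1 *m thi').
  apply/mem_khom => a /=; rewrite (refl_arr rM) -mulmxA -f1E.
  by rewrite -[in RHS]mulmxA -(refl_arrI rM') mulmxA.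
by rewrite /= -[RHS]mulmxA (refl_thiK rM') mulmx1.
Qed.

End Reflections.

(** * Iterated reflections of representations of dimension vector (q, 1) *)

Section ReflectionChains.
Local Open Scope ring_scope.
Variables (F : fieldType) (n : nat).
Implicit Types M N P Q U L : krep F n.

Fixpoint reflection_chain (q k : nat) Q : Prop :=
  if k is k'.+1 then exists2 N, reflection_chain q k' N & reflection Q N
  else [/\ dim1 Q = q, dim2 Q = 1%N & arrows_span Q].

(** By induction, dim Q_1 = n dim N_1 - dim N_2 >= (n - 1) dim N_1 >= dim N_1 = dim Q_2. *)
Lemma reflection_chain_dims q k Q : (1 < n)%N -> (0 < q)%N ->
  reflection_chain q k Q -> (0 < dim1 Q)%N /\ (dim2 Q <= dim1 Q)%N.
Proof.
move=> n1 q0; elim: k Q => [|k IH] Q /=; first by case=> -> ->.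
move=> [N /IH[N0 N21] [c [th [thi /refl_dim[d1 ->]]]]].
by split; nia.
Qed.

Lemma span_sub_full U Q (i : vmaps U Q) :
  arrows_span Q -> i \in khom U Q -> row_full i.2 -> row_full i.1.
Proof.
move=> sQ /mem_khom iH i2; have [x x1] := sQ _ 1%:M.
have /fin_all_exists[x' xx'] a := row_full_lift (x a) i2.
apply/row_fullP; exists (\sum_a x' a *m arr U a).
rewrite x1 mulmx_suml; apply: eq_bigr => a _.
by rewrite xx' -!mulmxA iH.
Qed.

(* Replacing U by the subrepresentation generated by U_2 only removes copies of
   the simple projective, and the left exact R^+ maps the result into N. *)
Lemma reflection_chain_sub_ext q k Q U (i : vmaps U Q) :
  reflection_chain q k Q -> i \in khom U Q -> row_free i.1 -> row_free i.2 ->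
  (row_full i.1 /\ row_full i.2) \/ cocycles_trivial U Q.
Proof.
elim: k Q U i => [|k IH] Q U i /=.
  case=> _ Q2 sQ iH i1 i2; have le := rank_leq_col i.2; rewrite (eqP i2) Q2 in le.
  (* If U_2 = 0, all cocycles are zero; otherwise U_2 fills the line Q_2, which generates Q. *)
  have [U2|U2] := posnP (dim2 U).
    right=> eta; exists 0 => a; apply/matrixP => x; exfalso.
    by case: x => x; rewrite U2.
  have i2f : row_full i.2 by rewrite /row_full (eqP i2) Q2; lia.
  by left; split=> //; apply: (span_sub_full sQ iH).
move=> [N cN [c [th [thi rQ]]]] iH i1 i2; have /mem_khom iE := iH.
pose Phi := \mxcol_a arr U a.
pose U' : krep F n := KRep (fun a => submxcol (col_base Phi) a).
have arrU a : arr U a = arr U' a *m row_base Phi.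
  rewrite /= submxcol_mul mulmx_base.
  by rewrite /Phi mxcolK.
have rU' : reflection U' (kernel_rep (arr U')).
  apply: reflection_kernel => r z; apply: row_full_mxcolP.
  by rewrite /= submxcolK; apply: col_base_full.
set L := kernel_rep _ in rU'.
have [|j2 j2E] := @refl_exact _ _ _ _ _ _ _ rQ _
    (fun a => arr L a *m (i.2 *m th)).
  under eq_bigr do rewrite -!mulmxA -(refl_arr rQ) -iE arrU !mulmxA.
  by rewrite -!mulmx_suml mxcol_ker_complex !mul0mx.
have j1f : row_free (i.2 *m th).
  apply: row_freeW => r x; rewrite mulmxA => /(congr1 (mulmx^~ thi)).
  rewrite -mulmxA (refl_thK rQ) mulmx1 mul0mx; exact: row_free_inj0.
have j2f : row_free j2.
  apply: row_freeW => r x xj; apply: (@mxcol_ker_inj _ _ _ _ (arr U')) => a.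
  by apply: (row_free_inj0 j1f); rewrite -mulmxA j2E mulmxA xj mul0mx.
have [] := IH N L (i.2 *m th, j2) cN _ j1f j2f.
- by apply/mem_khom.
(* If L_1 = U_2 fills N_1 = Q_2, then U contains everything generated by Q_2, that is Q. *)
- move=> [/row_fullP[B Bi] _]; left.
  suff i2f : row_full i.2 by split=> //; apply: (span_sub_full (refl_span rQ) iH).
  apply/row_fullP; exists (th *m B).
  rewrite -[LHS]mulmx1 -(refl_thK rQ) -!mulmxA.
  by rewrite [i.2 *m _]mulmxA [B *m _]mulmxA Bi mul1mx (refl_thK rQ).
move=> /(reflection_cocycles rU' (ex_intro _ c (ex_intro _ th (ex_intro _ thi rQ)))).
move=> ext; right=> eta; have [f fE] := ext eta.
(* Cocycles of U and U' are the same data since U_2 = U'_2; it remains to extend [f.1] linearly from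
   U'_1 to U_1. *)
have [f1 f1E] := row_free_extend f.1 (row_base_free Phi).
by exists (f1, f.2) => a; rewrite fE /intertwine -f1E mulmxA -arrU.
Qed.

(** A vector killed by all arrows spans a subrepresentation of dimension vector (0, 1), proper
    because Q_1 is nonzero. Triviality of its cocycles in Q makes Q_2 -> Q_1^n surjective, against
    dim Q_2 <= dim Q_1 < n dim Q_1. *)
Lemma reflection_chain_inj q k Q : (1 < n)%N -> (0 < q)%N ->
  reflection_chain q k Q -> arrows_joint_inj Q.
Proof.
move=> n1 q0 cQ r y yQ; have [Q1 Q21] := reflection_chain_dims n1 q0 cQ.
apply/row_matrixP => s; rewrite row0; apply/eqP; apply: contraT => ys.
pose U : krep F n := @KRep F n 0 1 (fun=> 0).
have [] := @reflection_chain_sub_ext q k Q U (0, row s y) cQ.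
- apply/mem_khom => a /=.
  by rewrite mul0mx -row_mul yQ row0.
- by rewrite /row_free mxrank0.
- by rewrite /row_free rank_rV ys.
- by case; rewrite /row_full mxrank0 /= => /eqP E; rewrite -E in Q1.
move=> ext; suff : (n * dim1 Q <= dim2 Q)%N by nia.
have full : row_full (\mxrow_a arr Q a).
  rewrite -sub1mx; apply/row_subP => b; rewrite rowE mulmx1.
  have [f fE] := ext (fun a => submxrow (delta_mx 0 b) a).
  apply/submxP; exists (- f.2); rewrite -[LHS]submxrowK mul_mxrow.
  apply/eq_mxrowP => a; rewrite fE /intertwine /= mul0mx.
  by rewrite sub0r mulNmx.
have := rank_leq_row (\mxrow_a arr Q a).
by rewrite (eqP full) sum_nat_const card_ord.
Qed.

(** Isomorphism up to the action of GL_n on the arrows. Bijectivity is stated by ranks because the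
    two sides have dimensions that are not convertible. *)
Definition twisted_iso M M' : Prop :=
  exists (g : 'M[F]_n) (t1 : 'M[F]_(dim1 M, dim1 M')) (t2 : 'M[F]_(dim2 M, dim2 M')),
    [/\ g \in unitmx, row_free t1 /\ row_full t1, row_free t2 /\ row_full t2
      & forall a, t2 *m arr M' a = \sum_b g a b *: (arr M b *m t1)].

Lemma iso_dim k l (t : 'M[F]_(k, l)) : row_free t -> row_full t -> k = l.
Proof. by move=> /eqP E /eqP; rewrite E. Qed.

Lemma iso_inv k l (t : 'M[F]_(k, l)) : row_free t -> row_full t ->
  exists2 s, t *m s = 1%:M & s *m t = 1%:M.
Proof.
move=> /row_freeP[s ts] /row_fullP[s' s't]; exists s => //.
by rewrite -[s]mul1mx -s't -[s' *m t *m s]mulmxA ts mulmx1.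
Qed.

Lemma inv_iso k l (t : 'M[F]_(k, l)) s :
  t *m s = 1%:M -> s *m t = 1%:M -> row_free t /\ row_full t.
Proof. by split; [apply/row_freeP; exists s | apply/row_fullP; exists s]. Qed.

(** The relation pairing the arrows of N with the maps [c] persists when the latter transform
    contragrediently, so [g] becomes its inverse transpose. The map [t] at vertex 1 is induced on
    cokernels. *)
Lemma twisted_iso_reflection M N M' N' :
  reflection M N -> reflection M' N' -> twisted_iso N N' -> twisted_iso M M'.
Proof.
move=> [c [th [thi rM]]] [c' [th' [thi' rM']]].
move=> [g [t1 [t2 [gu [t1f t1F] [t2f t2F] tE]]]].
have [|t ct] := @refl_factor _ _ _ _ _ _ _ rM _ (fun b => \sum_a g a b *: (t1 *m c' a)).
  transitivity (t2 *m \sum_a arr N' a *m c' a); last first.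
    by rewrite (refl_complex rM') mulmx0.
  under eq_bigr do rewrite mulmx_sumr; rewrite exchange_big mulmx_sumr.
  apply: eq_bigr => a _; rewrite mulmxA tE mulmx_suml; apply: eq_bigr => b _.
  by rewrite -scalemxAr -scalemxAl mulmxA.
have tc a : t1 *m c' a = \sum_b invmx g b a *: (c b *m t).
  under eq_bigr do rewrite -ct scaler_sumr; rewrite exchange_big /=.
  transitivity (\sum_j (g *m invmx g) j a *: (t1 *m c' j)).
    rewrite mulmxV // (bigD1 a) //= big1 ?addr0 ?mxE ?eqxx ?scale1r //.
    by move=> j ja; rewrite mxE (negPf ja) scale0r.
  apply: eq_bigr => j _; rewrite mxE scaler_suml; apply: eq_bigr => b _.
  by rewrite scalerA mulrC.
have [d1 d2] := refl_dim rM; have [d1' d2'] := refl_dim rM'.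
have E1 := iso_dim t1f t1F; have E2 := iso_dim t2f t2F.
have tF : row_full t.
  have [x x1] := refl_surj rM' 1%:M.
  have /fin_all_exists[x' xx'] a := row_full_lift (x a) t1F.
  apply/row_fullP; exists (\sum_a x' a *m \sum_b invmx g b a *: c b).
  rewrite x1 mulmx_suml; apply: eq_bigr => a _; rewrite xx' -!mulmxA tc.
  by rewrite mulmx_suml; congr (_ *m _); apply: eq_bigr => b _; rewrite scalemxAl.
exists (invmx g)^T, t, (th *m t1 *m thi'); split.
- by rewrite unitmx_tr unitmx_inv.
(* [t] is surjective, and [refl_dim] gives both sides the same dimension. *)
- split=> //; rewrite /row_free (eqP tF); apply/eqP; lia.
- have [s ts st] := iso_inv t1f t1F; apply: (@inv_iso _ _ _ (th' *m s *m thi)).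
    rewrite !mulmxA -[_ *m thi' *m th']mulmxA (refl_thiK rM') mulmx1.
    by rewrite -[th *m t1 *m s]mulmxA ts mulmx1 (refl_thK rM).
  rewrite !mulmxA -[_ *m thi *m th]mulmxA (refl_thiK rM) mulmx1.
  by rewrite -[th' *m s *m t1]mulmxA st mulmx1 (refl_thK rM').
move=> a; rewrite -mulmxA -(refl_arrI rM') -mulmxA tc mulmx_sumr.
apply: eq_bigr => b _; rewrite -scalemxAr mulmxA -(refl_arr rM).
by rewrite mxE.
Qed.

(** A representation of dimension vector (q, 1) is an n x q matrix, of rank q when its arrows span.
    Two such matrices have the same rank normal form, hence differ by invertible row and column
    operations; the row operations are the twist [g]. *)
Lemma reflection_chain_twisted_iso q k Q Q' :
  reflection_chain q k Q -> reflection_chain q k Q' -> twisted_iso Q Q'.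
Proof.
elim: k Q Q' => [|k IH] Q Q' /=; last first.
  by move=> [N cN rN] [N' cN' rN']; apply: (twisted_iso_reflection rN rN'); apply: IH.
case: Q => d1 d2 A; case: Q' => d1' d2' A' /= [d1E d2E sA] [d1E' d2E' sA'].
rewrite {}d1E {}d2E in A sA *; rewrite {}d1E' {}d2E' in A' sA' *.
pose B : 'M_(n, q) := \matrix_(a, j) A a 0 j.
pose B' : 'M_(n, q) := \matrix_(a, j) A' a 0 j.
have rk (C : 'I_n -> 'M[F]_(1, q)) :
    arrows_span (KRep C) -> \rank (\matrix_(a, j) C a 0 j) = q.
  move=> sC; have [x x1] := sC _ 1%:M; apply/eqP/row_fullP.
  exists (\matrix_(l, a) x a l 0); apply/matrixP=> l j.
  rewrite x1 summxE mxE; apply: eq_bigr => a _.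
  by rewrite !mxE big_ord1.
have rB : \rank B = q by apply: rk.
have rB' : \rank B' = q by apply: rk.
pose t1 := invmx (row_ebase B) *m row_ebase B'.
pose g := col_ebase B' *m invmx (col_ebase B).
have gB : g *m B *m t1 = B'.
  rewrite -[B]mulmx_ebase -[RHS]mulmx_ebase rB rB' /g /t1 !mulmxA.
  rewrite -[_ *m invmx (col_ebase B) *m _]mulmxA mulVmx ?col_ebase_unit // mulmx1.
  by rewrite -[_ *m row_ebase B *m _]mulmxA mulmxV ?row_ebase_unit // mulmx1.
exists g, t1, 1%:M; split=> /=.
- by rewrite unitmx_mul unitmx_inv !col_ebase_unit.
- have t1u : t1 \in unitmx by rewrite unitmx_mul unitmx_inv !row_ebase_unit.
  by rewrite row_free_unit row_full_unit.
- by rewrite row_free_unit row_full_unit unitmx1.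
move=> a; rewrite mul1mx; apply/rowP => j.
have -> : A' a 0 j = B' a j by rewrite mxE.
rewrite -gB -mulmxA mxE summxE; apply: eq_bigr => b _.
rewrite !mxE; congr (_ * _); apply: eq_bigr => l _; by rewrite mxE.
Qed.

End ReflectionChains.

(** * Preprojectives: Euler form, scalar endomorphisms and reflection to smaller index *)

Section Preprojectives.
Local Open Scope ring_scope.
Variables (F : fieldType) (n : nat).
Implicit Types M N P Q U L : krep F n.

Definition scalar_end P : Prop :=
  forall f : vmaps P P, f \in khom P P -> exists s : F, f = (s%:M, s%:M).

(** The cokernel matrix of P_2^n -> P_1, together with zero at vertex 2, is an endomorphism. It is
    scalar, and since P_2 is nonzero the scalar is 0. *)
Lemma scalar_end_span P : (0 < dim2 P)%N -> scalar_end P -> arrows_span P.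
Proof.
move=> P2 sP k z; apply: row_full_mxcolP; rewrite -cokermx_eq0.
set Phi := \mxcol_a _.
have [|s [-> s0]] := sP (cokermx Phi, 0).
  apply/mem_khom => a /=; rewrite mul0mx.
  have := congr1 (fun B => submxcol B a) (mulmx_coker Phi).
  by rewrite mxcol_mul mxcolK submxcol0.
have := congr1 (fun B : 'M_(dim2 P) => B (Ordinal P2) (Ordinal P2)) s0.
by rewrite !mxE eqxx mulr1n => <-; rewrite raddf0.
Qed.

(** An endomorphism [g] of N lifts to a scalar one of P, so [g.1] is scalar; joint injectivity of
    the arrows of N then determines [g.2]. *)
Lemma scalar_end_reflection P N : reflection P N -> scalar_end P -> scalar_end N.
Proof.
move=> [c [th [thi rP]]] sP g gH; have [f fH fg] := reflection_hom_up rP rP gH.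
have [s fs] := sP f fH; exists s.
have g1 : g.1 = s%:M.
  rewrite -[g.1]mul1mx -(refl_thiK rP) -mulmxA fg fs /= mul_scalar_mx.
  by rewrite -scalemxAr (refl_thiK rP) scalemx1.
rewrite [g]surjective_pairing g1; congr pair; apply/eqP; rewrite -subr_eq0.
apply/eqP/(refl_inj rP) => a; rewrite mulmxBl.
by move/mem_khom: gH => <-; rewrite g1 scalar_mxC subrr.
Qed.

(* A cocycle [eta] is the class of the extension with arrows
   [[arr N, 0], [eta, arr M]]; a section of it exhibits [eta] as a coboundary. *)
Lemma Ext1_zero_cocycles M N : Ext1_zero M N -> cocycles_trivial M N.
Proof.
move=> ext eta.
pose E : krep F n := KRep (fun a => block_mx (arr N a) 0 (eta a) (arr M a)).
pose i : vmaps N E := (row_mx 1%:M 0, row_mx 1%:M 0).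
pose p : vmaps E M := (col_mx 0 1%:M, col_mx 0 1%:M).
have fr k l : row_free (row_mx 1%:M 0 : 'M[F]_(k, k + l)).
  apply/row_freeP; exists (col_mx 1%:M 0).
  by rewrite mul_row_col mulmx1 mulmx0 addr0.
have fu k l : row_full (col_mx 0 1%:M : 'M[F]_(k + l, l)).
  apply/row_fullP; exists (row_mx 0 1%:M).
  by rewrite mul_row_col mulmx1 mulmx0 add0r.
have ke k l : (kermx (col_mx 0 1%:M : 'M[F]_(k + l, l))
    == (row_mx 1%:M 0 : 'M_(k, k + l)))%MS.
  apply/andP; split; last first.
    by apply/sub_kermxP; rewrite mul_row_col mulmx0 mul0mx addr0.
  have := mulmx_ker (col_mx 0 1%:M : 'M[F]_(k + l, l)); set K := kermx _ => K0.
  apply/submxP; exists (lsubmx K); rewrite mul_mx_row mulmx1 mulmx0.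
  rewrite -[LHS]hsubmxK; congr row_mx.
  by move: K0; rewrite -{1}[K]hsubmxK mul_row_col mulmx0 mulmx1 add0r.
have [|s [sH s1 s2]] := ext E i p.
  split; rewrite /i /= ?fr //.
    by apply/mem_khom => a /=; rewrite mul_mx_row mul_row_block !mulmx1 !mulmx0
       !mul0mx !addr0 mul1mx.
  split; rewrite /p /= ?fu ?ke //.
  by apply/mem_khom => a /=; rewrite mul_block_col mul_col_mx !mulmx1 !mulmx0
     mul0mx !mul1mx !add0r.
have split_row k l (X : 'M[F]_(l, k + l)) : X *m col_mx 0 1%:M = 1%:M ->
    X = row_mx (lsubmx X) 1%:M.
  rewrite -{1}[X]hsubmxK mul_row_col mulmx0 mulmx1 add0r => <-.
  by rewrite hsubmxK.
move/mem_khom in sH; exists (lsubmx s.1, lsubmx s.2) => a.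
have := sH a => E0; rewrite (split_row _ _ s.1 s1) (split_row _ _ s.2 s2) /= in E0.
move: E0; rewrite mul_mx_row mul_row_block => /eq_row_mx[E1 _].
by rewrite /intertwine /= E1 mul1mx addrAC subrr add0r.
Qed.

(** The differential of the two-term complex with kernel Hom(M, N) and cokernel Ext^1(M, N). *)
Definition boundary M N (f : vmaps M N) : 'M[F]_(dim2 M, \sum_(a < n) dim1 N) :=
  \mxrow_a intertwine a f.

Fact boundary_is_linear M N : linear (@boundary M N).
Proof.
by move=> s f g; apply/matrixP=> x y; rewrite [LHS]mxE linearP !mxE.
Qed.

HB.instance Definition _ M N := GRing.isLinear.Build F (vmaps M N)
  'M[F]_(dim2 M, \sum_(a < n) dim1 N) *:%R (@boundary M N) (@boundary_is_linear M N).

Lemma khomE M N : khom M N = lker (linfun (@boundary M N)).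
Proof.
apply/vspaceP => f; rewrite memv_ker lfunE /=.
apply/mem_khom/eqP => [fH | f0 a].
  apply/mxrowP => a; rewrite mxrowK submxrow0.
  by rewrite /intertwine fH subrr.
have := congr1 (fun B => submxrow B a) f0.
by rewrite mxrowK submxrow0 => /eqP; rewrite subr_eq0 => /eqP.
Qed.

(** Rank-nullity for a surjective [boundary]: dim Hom(M, N) is the value of the Euler form. *)
Lemma cocycles_trivial_dim M N : cocycles_trivial M N ->
  (\dim (khom M N) + n * (dim2 M * dim1 N) =
   dim1 M * dim1 N + dim2 M * dim2 N)%N.
Proof.
move=> ext; have := limg_ker_dim (linfun (@boundary M N)) fullv.
rewrite capfv -khomE dimvf /=.
have -> : limg (linfun (@boundary M N)) = fullv.
  apply/eqP; rewrite eqEsubv subvf /=; apply/subvP => B _.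
  have [f fE] := ext (fun a => submxrow B a).
  apply/memv_imgP; exists f; first exact: memvf.
  rewrite lfunE /= -[LHS]submxrowK; exact/eq_mxrowP.
rewrite dimvf /dim /= sum_nat_const card_ord => <-.
by congr (_ + _)%N; rewrite mulnCA.
Qed.

Lemma useq_euler k :
  useq n k.+1 * useq n k.+1 + useq n k * useq n k
  - n%:Z * (useq n k * useq n k.+1) = 1.
Proof.
elim: k => [|k IH]; first by rewrite /= !(mulr0, mul0r, mulr1, addr0, subr0).
have -> : useq n k.+2 = n%:Z * useq n k.+1 - useq n k by [].
by rewrite -{}[RHS]IH; ring.
Qed.

Lemma useq_gt0 k : (1 < n)%N -> (0 < useq n k.+1)%R /\ (useq n k <= useq n k.+1)%R.
Proof.
move=> n1; elim: k => [|k [IH1 IH2]] //.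
have -> : useq n k.+2 = n%:Z * useq n k.+1 - useq n k by [].
by split; nia.
Qed.

(** The properties of P_m that are carried down along reflections. *)
Definition kronecker_brick (m : nat) P : Prop :=
  [/\ (dim1 P)%:Z = useq n m, (dim2 P)%:Z = useq n m.-1 & scalar_end P].

(** With Ext^1(P, P) = 0 the dimension of End(P) equals the Euler form, which is 1, and the identity
    spans it. *)
Lemma preprojective_brick m P : (1 < n)%N ->
  preprojective m.+1 P -> kronecker_brick m.+1 P.
Proof.
move=> n1 [P1 P2 _ /Ext1_zero_cocycles/cocycles_trivial_dim dE]; split=> // f fH.
have d1 : \dim (khom P P) = 1%N.
  have := useq_euler m; rewrite -P1 -[useq n m]P2; lia.
have P1_gt0 : (0 < dim1 P)%N by have [] := useq_gt0 m n1; rewrite -P1.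
pose e : vmaps P P := (1%:M, 1%:M).
have e0 : e != 0.
  apply/eqP => -[/matrixP/(_ (Ordinal P1_gt0) (Ordinal P1_gt0))] /eqP.
  by rewrite !mxE eqxx oner_eq0.
have /eqP E : <[e]>%VS == khom P P.
  rewrite eqEdim d1 dim_vline e0 andbT -memvE.
  by apply/mem_khom => a; rewrite mulmx1 mul1mx.
move: fH; rewrite -E => /vlineP[s ->]; exists s.
by rewrite /e; congr pair; rewrite /= scalemx1.
Qed.

(** R^+ sends (u_{m+2}, u_{m+1}) to (u_{m+1}, n u_{m+1} - u_{m+2}), and the last entry is u_m. *)
Lemma brick_reflection m P : (1 < n)%N -> kronecker_brick m.+2 P ->
  exists2 N, reflection P N & kronecker_brick m.+1 N.
Proof.
move=> n1 [P1 P2 sP].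
have P2_gt0 : (0 < dim2 P)%N by have [] := useq_gt0 m n1; rewrite -P2.
have rP := reflection_kernel (scalar_end_span P2_gt0 sP).
eexists; first exact: rP.
split; [ | | exact: scalar_end_reflection sP].
  by case: rP => c [th [thi /refl_dim[_ <-]]].
case: rP => c [th [thi /refl_dim[d1 d2]]].
have E : useq n m.+2 = n%:Z * useq n m.+1 - useq n m by [].
by move: P1; rewrite E -[useq n m.+1]P2 -[m.+1.-1]/m; rewrite -d2 in d1; nia.
Qed.

End Preprojectives.

(** * Cokernels of families of maps and their descent to the case m = 1 *)

Section Truncations.
Local Open Scope ring_scope.
Variables (F : fieldType) (n : nat).
Implicit Types M N P Q U L : krep F n.

(** The cokernel of P^d -> P' for an indexed family instead of the basis of a subspace, so that a
    family and its reflection correspond index by index. *)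
Definition family_coker P P' d (v : 'I_d -> vmaps P P') Q (p : vmaps P' Q) : Prop :=
  [/\ p \in khom P' Q, row_full p.1, row_full p.2,
      (kermx p.1 == \mxcol_i (v i).1)%MS & (kermx p.2 == \mxcol_i (v i).2)%MS].

Lemma mxcol_cokernel d k l (v : 'I_d -> 'M[F]_(k, l)) :
  exists r (p : 'M[F]_(l, r)), row_full p /\ (kermx p == \mxcol_i v i)%MS.
Proof.
set Phi := \mxcol_i v i.
exists _, (col_base (cokermx Phi)); split; first exact: col_base_full.
apply/andP; split.
  rewrite submxE; apply/eqP; set K := kermx _.
  transitivity (K *m (col_base (cokermx Phi) *m row_base (cokermx Phi))).
    by rewrite mulmx_base.
  by rewrite mulmxA mulmx_ker mul0mx.
apply/sub_kermxP; apply: (row_free_inj0 (row_base_free (cokermx Phi))).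
by rewrite -mulmxA mulmx_base mulmx_coker.
Qed.

Lemma family_coker_factor d k l r s (v : 'I_d -> 'M[F]_(k, l)) (p : 'M[F]_(l, r))
    (u : 'M_(l, s)) :
  row_full p -> (kermx p == \mxcol_i v i)%MS -> (forall i, v i *m u = 0) ->
  exists f, u = p *m f.
Proof.
move=> pf /andP[/submxP[y ky] _] vu; apply: row_full_factor => //.
rewrite ky -mulmxA mxcol_mul.
suff -> : \mxcol_i (v i *m u) = 0 by rewrite mulmx0.
by rewrite -[RHS](@mxcol0 _ _ (fun=> k)); apply/eq_mxcolP.
Qed.

Lemma family_coker_zero d k l r (v : 'I_d -> 'M[F]_(k, l)) (p : 'M[F]_(l, r)) i :
  (kermx p == \mxcol_i v i)%MS -> v i *m p = 0.
Proof.
move=> /andP[_ /sub_kermxP]; rewrite mxcol_mul => E.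
by have := congr1 (fun B => submxcol B i) E; rewrite mxcolK submxcol0.
Qed.

Lemma family_coker_ker d k l r s (v : 'I_d -> 'M[F]_(k, l)) (p : 'M[F]_(l, r))
    (z : 'M_(s, l)) :
  (kermx p == \mxcol_i v i)%MS -> z *m p = 0 ->
  exists x : 'I_d -> 'M_(s, k), z = \sum_i x i *m v i.
Proof.
move=> /andP[kv _] /sub_kermxP zk; have /submxP[x ->] := submx_trans zk kv.
by exists (fun i => submxrow x i); rewrite -{1}[x]submxrowK mul_mxrow_mxcol.
Qed.

Lemma family_coker_exists P P' d (v : 'I_d -> vmaps P P') :
  (forall i, v i \in khom P P') -> exists Q (p : vmaps P' Q), family_coker v p.
Proof.
move=> vH; have [r1 [p1 [p1f p1k]]] := mxcol_cokernel (fun i => (v i).1).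
have [r2 [p2 [p2f p2k]]] := mxcol_cokernel (fun i => (v i).2).
have /fin_all_exists[A AE] a : exists A, arr P' a *m p1 = p2 *m A.
  apply: (family_coker_factor p2f p2k) => i.
  have /mem_khom vE := vH i.
  by rewrite mulmxA -vE -mulmxA (family_coker_zero i p1k) mulmx0.
exists (KRep A), (p1, p2); split=> //; exact/mem_khom.
Qed.

(** Right exactness of R^-: the reflection of coker(w) is coker(v). The structure maps [C], [t] and
    [ti] come from the universal properties of the cokernels; joint injectivity of [QN] gives
    exactness on the left. *)
Lemma family_coker_reflection P N P' N' c th thi c' th' thi' d
    (v : 'I_d -> vmaps P P') (w : 'I_d -> vmaps N N') Q QN
    (p : vmaps P' Q) (q : vmaps N' QN) :
  @is_reflection F n P N c th thi -> @is_reflection F n P' N' c' th' thi' ->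
  (forall i, th *m (w i).1 = (v i).2 *m th') ->
  (forall i a, (w i).1 *m c' a = c a *m (v i).1) ->
  family_coker v p -> family_coker w q -> arrows_joint_inj QN ->
  reflection Q QN.
Proof.
move=> rP rP' wv wc [/mem_khom pH p1f p2f p1k p2k] [/mem_khom qH q1f q2f q1k q2k] QNi.
have [t pt] : exists t, th' *m q.1 = p.2 *m t.
  apply: (family_coker_factor p2f p2k) => i.
  by rewrite mulmxA -wv -mulmxA (family_coker_zero i q1k) mulmx0.
have [ti qti] : exists ti, thi' *m p.2 = q.1 *m ti.
  apply: (family_coker_factor q1f q1k) => i.
  have -> : (w i).1 *m (thi' *m p.2) = thi *m ((v i).2 *m p.2).
    rewrite -[(w i).1]mul1mx -(refl_thiK rP) -[thi *m th *m _]mulmxA wv.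
    by rewrite !mulmxA -[_ *m th' *m thi']mulmxA (refl_thK rP') mulmx1.
  by rewrite (family_coker_zero i p2k) mulmx0.
have /fin_all_exists[C CE] a : exists C, c' a *m p.1 = q.1 *m C.
  apply: (family_coker_factor q1f q1k) => i.
  by rewrite mulmxA wc -mulmxA (family_coker_zero i p1k) mulmx0.
exists C, t, ti; split=> //.
- apply: (row_full_cancel p2f); rewrite mulmxA -pt -mulmxA -qti mulmxA.
  by rewrite (refl_thK rP') mul1mx mulmx1.
- apply: (row_full_cancel q1f); rewrite mulmxA -qti -mulmxA -pt mulmxA.
  by rewrite (refl_thiK rP') mul1mx mulmx1.
- move=> a; apply: (row_full_cancel p2f).
  by rewrite -pH mulmxA -pt -mulmxA -CE mulmxA (refl_arr rP').
- apply: (row_full_cancel q2f); rewrite mulmx0 mulmx_sumr.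
  under eq_bigr do rewrite mulmxA -qH -mulmxA -CE mulmxA.
  by rewrite -mulmx_suml (refl_complex rP') mul0mx.
(* Diagram chase for exactness in the middle: a lift of [x] to N'_1^n maps to a combination of the
   [v i]. Lifting its coefficients to N_1^n and subtracting their images under the [w i] leaves a
   family coming from N'_2. *)
- move=> k x xC; have /fin_all_exists[x' xE] a := row_full_lift (x a) q1f.
  have [|s sE] := @family_coker_ker _ _ _ _ _ _ _ (\sum_a x' a *m c' a) p1k.
    rewrite mulmx_suml -[RHS]xC; apply: eq_bigr => a _.
    by rewrite xE -!mulmxA CE.
  have /fin_all_exists[s' s'E] i := refl_surj rP (s i).
  have [|y yE] := @refl_exact _ _ _ _ _ _ _ rP' _
      (fun a => x' a - \sum_i s' i a *m (w i).1).
    under eq_bigr do rewrite mulmxBl mulmx_suml; rewrite sumrB exchange_big sE /=.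
    apply/eqP; rewrite subr_eq0; apply/eqP; apply: eq_bigr => i _.
    rewrite s'E mulmx_suml; apply: eq_bigr => a _.
    by rewrite -!mulmxA wc.
  exists (y *m q.2) => a; rewrite -mulmxA -qH mulmxA -yE mulmxBl -xE.
  rewrite mulmx_suml big1 ?subr0 // => i _.
  by rewrite -mulmxA (family_coker_zero i q1k) mulmx0.
move=> k z; have [z' ->] := row_full_lift z p1f.
have [x ->] := refl_surj rP' z'; exists (fun a => x a *m q.1).
by rewrite mulmx_suml; apply: eq_bigr => a _; rewrite -!mulmxA CE.
Qed.

(** [u] is a witness that the span of the independent family [v] is a proper subspace; it travels
    down with [v] and yields d < n at the bottom. *)
Definition independent_pair P P' d (v : 'I_d -> vmaps P P') (u : vmaps P P') :=
  forall (s : 'I_d -> F) (t : F), \sum_i s i *: v i + t *: u = 0 ->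
    (forall i, s i = 0) /\ t = 0.

Lemma fst_sum d (A B : lmodType F) (s : 'I_d -> F) (v : 'I_d -> A * B) :
  (\sum_i s i *: v i).1 = \sum_i s i *: (v i).1.
Proof. by elim/big_rec2: _ => //= i x y _ ->. Qed.

Lemma snd_sum d (A B : lmodType F) (s : 'I_d -> F) (v : 'I_d -> A * B) :
  (\sum_i s i *: v i).2 = \sum_i s i *: (v i).2.
Proof. by elim/big_rec2: _ => //= i x y _ ->. Qed.

(** A linear relation among the reflected maps holds for the original ones: at vertex 2 through the
    identifications, at vertex 1 because the maps [c] are jointly surjective. *)
Lemma independent_pair_reflection P N P' N' c th thi c' th' thi' d
    (v : 'I_d -> vmaps P P') (w : 'I_d -> vmaps N N') u uN :
  @is_reflection F n P N c th thi -> @is_reflection F n P' N' c' th' thi' ->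
  (forall i, th *m (w i).1 = (v i).2 *m th') ->
  (forall i a, (w i).1 *m c' a = c a *m (v i).1) ->
  th *m uN.1 = u.2 *m th' -> (forall a, uN.1 *m c' a = c a *m u.1) ->
  independent_pair v u -> independent_pair w uN.
Proof.
move=> rP rP' wv wc uv uc ind s t E; apply: ind.
have E1 : \sum_i s i *: (w i).1 + t *: uN.1 = 0.
  by rewrite -fst_sum -[LHS]/((_ + t *: uN).1) E.
have F2 : \sum_i s i *: (v i).2 + t *: u.2 = 0.
  rewrite -[LHS]mulmx1 -(refl_thK rP') mulmxA.
  suff -> : (\sum_i s i *: (v i).2 + t *: u.2) *m th' = 0 by rewrite mul0mx.
  rewrite mulmxDl mulmx_suml -scalemxAl -uv.
  under eq_bigr do rewrite -scalemxAl -wv scalemxAr.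
  by rewrite -mulmx_sumr scalemxAr -mulmxDr E1 mulmx0.
have F1 : \sum_i s i *: (v i).1 + t *: u.1 = 0.
  apply: (refl_cancel rP) => a; rewrite mulmx0 mulmxDr mulmx_sumr -scalemxAr -uc.
  under eq_bigr do rewrite -scalemxAr -wc scalemxAl.
  by rewrite -mulmx_suml scalemxAl -mulmxDl E1 mul0mx.
rewrite [LHS]surjective_pairing; congr pair.
  by rewrite /= fst_sum.
by rewrite /= snd_sum.
Qed.

(** The case of P_1 = (1, 0) and P_2 = (n, 1): a map is a vector of P'_1, so the cokernel divides
    the n-dimensional P'_1 by d independent vectors and leaves P'_2 unchanged. *)
Lemma family_coker_simple P P' d (v : 'I_d -> vmaps P P') u Q (p : vmaps P' Q) :
  dim1 P = 1%N -> dim2 P = 0%N -> dim1 P' = n -> dim2 P' = 1%N ->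
  arrows_span P' -> independent_pair v u -> family_coker v p ->
  (d < n)%N /\ reflection_chain (n - d) 0 Q.
Proof.
case: P v u => e1 e2 A /= v u P1 P2; rewrite {}P1 {}P2 in A v u *.
move=> P'1 P'2 sP' ind [/mem_khom pH p1f p2f p1k p2k].
have v2 (f : vmaps (KRep A) P') : f.2 = 0 by apply: flatmx0.
have lin (x : 'I_d -> 'M[F]_1) t : \sum_i x i *m (v i).1 + t *: u.1 = 0 ->
    (forall i, x i 0 0 = 0) /\ t = 0.
  move=> E; apply: ind; rewrite [LHS]surjective_pairing; congr pair; last exact: v2.
  rewrite /= fst_sum -[RHS]E; congr (_ + _); apply: eq_bigr => i _.
  by rewrite -mul_scalar_mx -mx11_scalar.
have vf : row_free (\mxcol_i (v i).1).
  apply: row_freeW => r x x0; apply/row_matrixP => j; rewrite row0.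
  rewrite -[LHS]submxrowK -[RHS](@mxrow0 _ _ (fun=> 1%N)); apply/eq_mxrowP => i.
  have := congr1 (row j) x0; rewrite row_mul row0.
  rewrite -[row j x]submxrowK mul_mxrow_mxcol => E.
  have [|E0 _] := lin (fun i => submxrow (row j x) i) 0.
    by rewrite scale0r addr0.
  have z1 (y : 'M[F]_1) : y 0 0 = 0 -> y = 0.
    by move=> y0; rewrite [y]mx11_scalar y0 raddf0.
  by rewrite mxrowK; exact: z1 (E0 i).
have rkv : \rank (\mxcol_i (v i).1) = d.
  by rewrite (eqP vf) sum_nat_const card_ord muln1.
have Q1 : (dim1 Q + d = n)%N.
  have := mxrank_ker p.1; rewrite (eqmxP p1k) rkv (eqP p1f) P'1 => ->.
  by rewrite subnKC //; have := rank_leq_row p.1; rewrite (eqP p1f) P'1.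
have dn : (d < n)%N.
  have dn : (d <= n)%N by lia.
  (* If d = n, the [v i] fill P'_1 and [u] depends on them. *)
  rewrite ltn_neqAle dn andbT; apply/eqP => E.
  have /submxP[x xE] : (u.1 <= \mxcol_i (v i).1)%MS.
    by apply: submx_full; rewrite /row_full rkv P'1 E.
  have [|_ /eqP] := lin (fun i => submxrow x i) (-1).
    rewrite xE -{2}[x]submxrowK mul_mxrow_mxcol scaleN1r; exact: subrr.
  by rewrite oppr_eq0 oner_eq0.
split=> //=; split; first by lia.
  have := mxrank_ker p.2; rewrite (eqmxP p2k) (eqP p2f).
  have -> : \mxcol_i (v i).2 = 0.
    by rewrite -[RHS](@mxcol0 _ _ (fun=> 0%N)); apply/eq_mxcolP => i; apply: v2.
  by rewrite mxrank0; have := rank_leq_row p.2; rewrite (eqP p2f) P'2; lia.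
move=> k z; have [z' ->] := row_full_lift z p1f; have [x ->] := sP' _ z'.
exists (fun a => x a *m p.2); rewrite mulmx_suml; apply: eq_bigr => a _.
by rewrite -!mulmxA pH.
Qed.

(** Both bricks and all maps are reflected down, the cokernel is formed there, and right exactness
    brings it back up. Joint injectivity for the lower cokernel comes from the chain the induction
    has just produced. *)
Lemma family_coker_chain k P P' d (v : 'I_d -> vmaps P P') u Q (p : vmaps P' Q) :
  (1 < n)%N -> kronecker_brick k.+1 P -> kronecker_brick k.+2 P' ->
  (forall i, v i \in khom P P') -> u \in khom P P' ->
  independent_pair v u -> family_coker v p ->
  (d < n)%N /\ reflection_chain (n - d) k Q.
Proof.
move=> n1; elim: k P P' v u Q p => [|k IH] P P' v u Q p bP bP' vH uH ind vp.
  case: bP bP' => /= P1 P2 _ [/= P'1 P'2 sP'].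
  apply: (family_coker_simple _ _ _ _ _ ind vp); try lia.
  by apply: scalar_end_span => //; lia.
have [N [c [th [thi rP]]] bN] := brick_reflection n1 bP.
have [N' [c' [th' [thi' rP']]] bN'] := brick_reflection n1 bP'.
have /fin_all_exists2[w wH wE] i := reflection_hom_down rP rP' (vH i).
have [uN uNH [uE1 uE2]] := reflection_hom_down rP rP' uH.
have wv i := proj1 (wE i); have wc i := proj2 (wE i).
have indN := independent_pair_reflection rP rP' wv wc uE1 uE2 ind.
have [QN [q wq]] := family_coker_exists wH.
have [dn cQN] := IH _ _ _ _ _ _ bN bN' wH uNH indN wq.
split=> //; exists QN => //.
apply: (family_coker_reflection rP rP' wv wc vp wq).
by apply: reflection_chain_inj cQN => //; rewrite subn_gt0.
Qed.

Lemma truncated_chain m P P' (V : {vspace vmaps P P'}) Q :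
  (1 < n)%N -> preprojective m.+1 P -> preprojective m.+2 P' ->
  proper_subspace V -> truncated V Q ->
  (\dim V < n)%N /\ reflection_chain (n - \dim V) m Q.
Proof.
move=> n1 /(preprojective_brick n1) bP /(preprojective_brick n1) bP'.
move=> [VH V0 Vn] [p pV].
(* Properness of V supplies a homomorphism outside V, independent of a basis of V. *)
have /subvPn[u uH uV] : ~~ (khom P P' <= V)%VS.
  by apply: contra Vn => ?; rewrite eqEsubv VH.
apply: (@family_coker_chain m P P' _ (fun i => tnth (vbasis V) i) u Q p) => //.
  by move=> i; apply: (subvP VH); apply: vbasis_mem; apply: mem_tnth.
move=> s t E.
have sV : \sum_i s i *: tnth (vbasis V) i \in V.
  by apply: memv_suml => i _; apply/memvZ/vbasis_mem/mem_tnth.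
have t0 : t = 0.
  apply: contraNeq uV => tn0; rewrite -[u]scale1r -(mulVf tn0) -scalerA.
  apply: memvZ; have /eqP := E; rewrite addrC addr_eq0 => /eqP ->.
  by rewrite memvN.
split=> // i; move: E; rewrite t0 scale0r addr0 => E.
have /freeP := basis_free (vbasisP V); apply.
by rewrite -[RHS]E; apply: eq_bigr => j _; rewrite (tnth_nth 0).
Qed.

End Truncations.

(** * Subspaces by basis matrices, and their minors *)

Section BasisMatrices.
Local Open Scope ring_scope.
Variable F : fieldType.

(** The number of rows is a parameter, tied to [\dim U] only by hypotheses, so that it can be [e.1]
    or [e.2] for every point. *)
Definition basis_mx k d (U : {vspace 'rV[F]_d}) : 'M[F]_(k, d) :=
  \matrix_(i < k, j < d) ((vbasis U)`_i) 0 j.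

Lemma pluckerE k d (U : {vspace 'rV[F]_d}) (I : {ffun 'I_k -> 'I_d}) :
  plucker U I = \det (colsub I (basis_mx k U)).
Proof. by congr (\det _); apply/matrixP => i j; rewrite !mxE. Qed.

Lemma row_basis_mx k d (U : {vspace 'rV[F]_d}) i :
  row i (basis_mx k U) = (vbasis U)`_i.
Proof. by apply/rowP => j; rewrite !mxE. Qed.

Lemma mem_basis_mx k d (U : {vspace 'rV[F]_d}) (x : 'rV_d) :
  \dim U = k -> (x \in U) = (x <= basis_mx k U)%MS.
Proof.
move=> <-; apply/idP/submxP => [/coord_vbasis -> | [y ->]].
  exists (\row_i coord (vbasis U) i x); rewrite mulmx_sum_row.
  by apply: eq_bigr => i _; rewrite row_basis_mx mxE.
rewrite mulmx_sum_row; apply: memv_suml => i _; apply: memvZ.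
by rewrite row_basis_mx; apply: vbasis_mem; apply: mem_nth; rewrite size_tuple.
Qed.

Lemma basis_mx_free k d (U : {vspace 'rV[F]_d}) :
  \dim U = k -> row_free (basis_mx k U).
Proof.
move=> <-; apply: row_freeW => r x x0; apply/matrixP => i j; rewrite mxE.
have /freeP/(_ (fun j => x i j)) := basis_free (vbasisP U); apply.
have := congr1 (row i) x0; rewrite row_mul row0 mulmx_sum_row => E.
by rewrite -[RHS]E; apply: eq_bigr => l _; rewrite row_basis_mx mxE.
Qed.

Definition row_vspace k d (X : 'M[F]_(k, d)) : {vspace 'rV[F]_d} :=
  limg (linfun (mulmxr X : 'rV_k -> 'rV_d)).

Lemma mem_row_vspace k d (X : 'M[F]_(k, d)) x : (x \in row_vspace X) = (x <= X)%MS.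
Proof.
apply/memv_imgP/submxP => [[y _ ->] | [y ->]]; first by exists y; rewrite lfunE.
by exists y; rewrite ?memvf ?lfunE.
Qed.

Lemma dim_img_free k d (X : 'M[F]_(k, d)) (U : {vspace 'rV_k}) :
  row_free X -> \dim (linfun (mulmxr X) @: U)%VS = \dim U.
Proof.
move=> Xf; apply: limg_dim_eq; apply/eqP; rewrite -subv0; apply/subvP => x.
rewrite memv_cap memv_ker lfunE /= memv0 => /andP[_ /eqP /(row_free_inj0 Xf) ->].
by [].
Qed.

Lemma dim_row_vspace k d (X : 'M[F]_(k, d)) : row_free X -> \dim (row_vspace X) = k.
Proof. by move=> Xf; rewrite dim_img_free // dimvf /dim /= mul1n. Qed.

Lemma row_space_unit k d (B X : 'M[F]_(k, d)) :
  row_free B -> (B <= X)%MS -> exists2 C, C \in unitmx & B = C *m X.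
Proof.
move=> Bf /submxP[C BC]; exists C => //; rewrite -row_free_unit.
by apply: row_freeW => r x xC; apply: (row_free_inj0 Bf); rewrite BC mulmxA xC mul0mx.
Qed.

Lemma basis_row_vspace k d (X : 'M[F]_(k, d)) : row_free X ->
  exists2 C, C \in unitmx & basis_mx k (row_vspace X) = C *m X.
Proof.
move=> Xf; have dX := dim_row_vspace Xf; apply: row_space_unit.
  exact: basis_mx_free.
by apply/row_subP => i; rewrite -mem_row_vspace (mem_basis_mx _ dX) row_sub.
Qed.

Lemma basis_mx_img k d d' (X : 'M[F]_(d, d')) (U : {vspace 'rV_d}) :
  row_free X -> \dim U = k ->
  exists2 C, C \in unitmx &
    basis_mx k (linfun (mulmxr X) @: U)%VS = C *m (basis_mx k U *m X).
Proof.
move=> Xf dU; have dX : \dim (linfun (mulmxr X) @: U)%VS = k by rewrite dim_img_free.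
apply: row_space_unit; first exact: basis_mx_free.
apply/row_subP => i; have := row_sub i (basis_mx k (linfun (mulmxr X) @: U)%VS).
rewrite -(mem_basis_mx _ dX) => /memv_imgP[y yU ->]; rewrite lfunE /=.
by apply: submxMr; rewrite -mem_basis_mx.
Qed.

Lemma subrep_basisP n (e : nat * nat) (Q : krep F n)
    (U : {vspace 'rV[F]_(dim1 Q)} * {vspace 'rV[F]_(dim2 Q)}) :
  reflect [/\ \dim U.1 = e.1, \dim U.2 = e.2
     & forall a, (basis_mx e.2 U.2 *m arr Q a <= basis_mx e.1 U.1)%MS]
    (subrep_pred e U).
Proof.
apply: (iffP and3P) => [[/eqP d1 /eqP d2 /forallP UH] | [d1 d2 UH]]; split; try exact/eqP.
- by [].
- by [].
- move=> a; apply/row_subP => i; rewrite row_mul -mem_basis_mx //.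
  apply: (subvP (UH a)); apply/memv_imgP; exists (row i (basis_mx e.2 U.2)).
    by rewrite (mem_basis_mx _ d2) row_sub.
  by rewrite lfunE.
apply/forallP => a; apply/subvP => y /memv_imgP[x xU ->]; rewrite lfunE /=.
rewrite (mem_basis_mx _ d1); apply: submx_trans (UH a).
by apply: submxMr; rewrite -mem_basis_mx.
Qed.

(** Multilinearity of the determinant in its columns: a Cauchy-Binet expansion over all tuples K,
    matching the indexing of the Plucker coordinates. It shows that a linear map acts linearly on
    them. *)
Lemma det_colsub_mul k d d' (B : 'M[F]_(k, d)) (X : 'M_(d, d')) (I : 'I_k -> 'I_d') :
  \det (colsub I (B *m X)) =
  \sum_(K : {ffun 'I_k -> 'I_d}) (\prod_j X (K j) (I j)) * \det (colsub K B).
Proof.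
have detE (A : 'M[F]_k) :
    \det A = \sum_(s : 'S_k) (-1) ^+ s * \prod_i A (s i) i.
  by rewrite -det_tr; apply: eq_bigr => s _; under eq_bigr do rewrite mxE.
under [RHS]eq_bigr do rewrite detE mulr_sumr.
rewrite detE.
rewrite exchange_big /=; apply: eq_bigr => s _.
transitivity ((-1) ^+ s * \sum_(K : {ffun 'I_k -> 'I_d})
     \prod_i (B (s i) (K i) * X (K i) (I i))).
  congr (_ * _); rewrite -(bigA_distr_bigA (fun i l => B (s i) l * X l (I i))).
  by apply: eq_bigr => i _; rewrite !mxE.
rewrite mulr_sumr; apply: eq_bigr => K _.
rewrite big_split /= [X in _ * X = _]mulrC mulrCA; congr (_ * (_ * _)).
by apply: eq_bigr => i _; rewrite !mxE.
Qed.

Lemma det_colsub_mull k d (C : 'M[F]_k) (X : 'M[F]_(k, d)) (I : 'I_k -> 'I_d) :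
  \det (colsub I (C *m X)) = \det C * \det (colsub I X).
Proof. by rewrite -det_mulmx mulmx_colsub. Qed.

Lemma row_free_minor k d (B : 'M[F]_(k, d)) : row_free B ->
  exists I : {ffun 'I_k -> 'I_d}, \det (colsub I B) != 0.
Proof.
move=> /row_freeP[X BX].
have : \det (colsub id (B *m X)) != 0 by rewrite BX mxsub_id det1 oner_eq0.
rewrite det_colsub_mul => nz; apply/existsP; apply: contraNT nz.
rewrite negb_exists => /forallP B0; rewrite big1 // => K _.
by have := B0 K; rewrite negbK => /eqP ->; rewrite mulr0.
Qed.

End BasisMatrices.

(** * Morphisms given by linear forms in homogeneous coordinates *)

Section LinearMorphisms.
Local Open Scope ring_scope.
Variable F : fieldType.

Lemma dhomog_bigprod N (I : finType) (f : I -> {mpoly F[N]}) (d : I -> nat) :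
  (forall i, f i \is (d i).-homog) -> \prod_i f i \is (\sum_i d i).-homog.
Proof.
move=> fd; elim/big_rec2: _ => [|i p e _ pe]; first exact: dhomog1.
exact: dhomogM.
Qed.

Lemma meval_dhomog N d (p : {mpoly F[N]}) (c : F) (v : 'I_N -> F) :
  p \is d.-homog -> p.@[fun i => c * v i] = c ^+ d * p.@[v].
Proof.
move=> /dhomogP pd; rewrite !mevalE mulr_sumr; apply: eq_big_seq => m ms.
have <- : mdeg m = d := pd m ms; rewrite mdegE mulrCA; congr (_ * _).
rewrite expr_sum -big_split /=; apply: eq_bigr => i _; exact: exprMn.
Qed.

Lemma dhomog_comp N N' d (p : {mpoly F[N]}) (lq : N.-tuple {mpoly F[N']}) :
  (forall i, tnth lq i \is 1.-homog) -> p \is d.-homog ->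
  p \mPo lq \is d.-homog.
Proof.
move=> l1 /dhomogP pd; rewrite comp_mpolyEX big_seq; apply: rpred_sum => m ms.
have <- : mdeg m = d := pd m ms; rewrite mdegE; apply: dhomogZ; rewrite comp_mpolyX.
by apply: dhomog_bigprod => i; have := dhomogMn (m i) (l1 i); rewrite mul1n.
Qed.

(** Substituting linear forms preserves the degree of homogeneous polynomials; the scalar [c], which
    varies with the point, cancels in quotients of equal degree. *)
Lemma linear_var_morphism (X Y : projvar F) (f : X -> Y)
    (L : 'I_(ncoord Y) -> 'I_(ncoord X) -> F) :
  (forall x, exists2 c, c != 0 &
     forall t, hcoord (f x) t = c * \sum_s L t s * hcoord x s) ->
  var_morphism f.
Proof.
move=> fL; pose lq : _.-tuple {mpoly F[ncoord X]} :=
  [tuple \sum_s L t s *: 'X_s | t < ncoord Y].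
have lq1 t : tnth lq t \is 1.-homog.
  rewrite tnth_mktuple; apply: rpred_sum => s _; apply: dhomogZ.
  by rewrite dhomogX; apply/eqP; apply: mdeg1.
have pullE x : exists2 c, c != 0 & forall d (p : {mpoly F[ncoord Y]}),
    p \is d.-homog -> p.@[hcoord (f x)] = c ^+ d * (p \mPo lq).@[hcoord x].
  have [c c0 cE] := fL x; exists c => // d p pd.
  rewrite comp_mpoly_meval -meval_dhomog //; apply: meval_eq => t.
  rewrite cE tnth_mktuple raddf_sum; congr (_ * _); apply: eq_bigr => s _.
  by rewrite /= mevalZ mevalXU.
have pullO (O : Y -> Prop) : zopen O -> zopen (fun x => O (f x)).
  move=> [S [Sh SO]]; exists (fun p' => exists2 p, S p & p' = p \mPo lq); split.
    by move=> _ [p /Sh[d pd] ->]; exists d; apply: dhomog_comp.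
  move=> x; have [c c0 cE] := pullE x; split.
    move=> /SO[p [Sp px]]; exists (p \mPo lq); split; first by exists p.
    have [d pd] := Sh p Sp; apply: contraNneq px => E.
    by rewrite (cE d p pd) E mulr0.
  move=> [_ [[p Sp ->] px]]; apply/SO; exists p; split=> //.
  have [d pd] := Sh p Sp; rewrite (cE d p pd) mulf_neq0 //; exact: expf_neq0.
split=> // O phi _ phiO x Ofx.
have [W [d [g [h [[Wo Wx] WO [gd hd] gh]]]]] := phiO _ Ofx.
exists (fun y => W (f y)), d, (g \mPo lq), (h \mPo lq); split.
- by split=> //; apply: pullO.
- by move=> y; apply: WO.
- by split; apply: dhomog_comp.
move=> y /gh[hy ->]; have [c c0 cE] := pullE y.
have hy' : (h \mPo lq).@[hcoord y] != 0.
  by apply: contraNneq hy => E; rewrite (cE d h hd) E mulr0.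
split=> //; rewrite (cE d g gd) (cE d h hd) -mulf_div divff ?mul1r //.
exact: expf_neq0.
Qed.

End LinearMorphisms.

(** * Twisted isomorphisms induce isomorphisms of quiver Grassmannians *)

Section TwistedIsomorphisms.
Local Open Scope ring_scope.
Variables (F : fieldType) (n : nat).
Implicit Types Q : krep F n.

Section Transport.
Variables (e : nat * nat) (Q Q' : krep F n).
Variables (t1 : 'M[F]_(dim1 Q, dim1 Q')) (t2 : 'M[F]_(dim2 Q, dim2 Q')).
Variable g : 'I_n -> 'I_n -> F.
Hypotheses (t1f : row_free t1) (t2f : row_free t2).
Hypothesis tg : forall a, t2 *m arr Q' a = \sum_b g a b *: (arr Q b *m t1).

Let img (U : {vspace 'rV[F]_(dim1 Q)} * {vspace 'rV[F]_(dim2 Q)}) :=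
  ((linfun (mulmxr t1) @: U.1)%VS, (linfun (mulmxr t2) @: U.2)%VS).

(** Up to [t1] and [t2], arrows of Q' are linear combinations of arrows of Q, which preserve any
    subrepresentation. *)
Lemma transport_subrep U : subrep_pred e U -> subrep_pred e (img U).
Proof.
move=> /subrep_basisP[d1 d2 UH]; apply/subrep_basisP.
split; rewrite /= ?dim_img_free // => a.
have [C1 C1u ->] := basis_mx_img t1f d1; have [C2 C2u ->] := basis_mx_img t2f d2.
rewrite -!mulmxA; apply: mulmx_sub.
rewrite (eqmxMfull (basis_mx e.1 U.1 *m t1)) ?row_full_unit // tg.
rewrite mulmx_sumr; apply: summx_sub => b _.
by rewrite -scalemxAr scalemx_sub // mulmxA submxMr.
Qed.

Definition transport (U : quiverGr e Q) : quiverGr e Q' :=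
  exist _ (img (val U)) (transport_subrep (valP U)).

(** The scalar is [\det C1 * \det C2], comparing the chosen basis of an image with the image of the
    chosen basis. *)
Lemma transport_morphism : var_morphism transport.
Proof.
apply: (@linear_var_morphism F (quiverGr e Q) (quiverGr e Q') _ (fun t s =>
  let IJ := @enum_val (coord_index e Q') predT t in
  let KL := @enum_val (coord_index e Q) predT s in
  (\prod_j t1 (KL.1 j) (IJ.1 j)) * (\prod_j t2 (KL.2 j) (IJ.2 j)))).
move=> [U UH] /=; have /subrep_basisP[d1 d2 _] := UH.
have [C1 C1u E1] := basis_mx_img t1f d1; have [C2 C2u E2] := basis_mx_img t2f d2.
rewrite unitmxE unitfE in C1u; rewrite unitmxE unitfE in C2u.
exists (\det C1 * \det C2); first exact: mulf_neq0.
move=> t; set IJ := enum_val t; rewrite !pluckerE E1 E2.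
rewrite !det_colsub_mull !det_colsub_mul mulrACA; congr (_ * _).
rewrite big_distrlr /= pair_big /=.
rewrite (reindex (fun s : 'I_#|coord_index e Q| => enum_val s)) /=; last first.
  by exists enum_rank => x _; rewrite ?enum_valK ?enum_rankK.
by apply: eq_bigr => s _; rewrite !pluckerE mulrACA.
Qed.

End Transport.

Lemma twisted_iso_var_iso e Q Q' :
  twisted_iso Q Q' -> var_iso (quiverGr e Q) (quiverGr e Q').
Proof.
move=> [g [t1 [t2 [gu [t1f t1F] [t2f t2F] tE]]]].
have [s1 ts1 st1] := iso_inv t1f t1F; have [s2 ts2 st2] := iso_inv t2f t2F.
have [s1f _] := inv_iso st1 ts1; have [s2f _] := inv_iso st2 ts2.
have sE b : s2 *m arr Q b = \sum_a invmx g b a *: (arr Q' a *m s1).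
  transitivity (s2 *m (\sum_a invmx g b a *: (t2 *m arr Q' a)) *m s1); last first.
    rewrite mulmx_sumr mulmx_suml; apply: eq_bigr => a _.
    by rewrite -scalemxAr -scalemxAl !mulmxA st2 mul1mx.
  rewrite -mulmxA; congr (_ *m _).
  under eq_bigr do rewrite tE scaler_sumr; rewrite exchange_big /=.
  transitivity (\sum_j (invmx g *m g) b j *: arr Q j).
    rewrite mulVmx // (bigD1 b) //= big1 ?addr0 ?mxE ?eqxx ?scale1r //.
    by move=> j jb; rewrite mxE eq_sym (negPf jb) scale0r.
  rewrite mulmx_suml; apply: eq_bigr => j _; rewrite mxE scaler_suml mulmx_suml.
  by apply: eq_bigr => a _; rewrite scalerA -scalemxAl -mulmxA ts1 mulmx1.
have imgK d d' (t : 'M[F]_(d, d')) s (U : {vspace 'rV_d}) : t *m s = 1%:M ->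
    (linfun (mulmxr s) @: (linfun (mulmxr t) @: U))%VS = U.
  move=> ts; rewrite -limg_comp.
  have -> : (linfun (mulmxr s) \o linfun (mulmxr t) = \1)%VF.
    by move=> r; apply/lfunP => x; rewrite !lfunE /= !lfunE /= -mulmxA ts mulmx1.
  exact: lim1g.
exists (transport (e := e) t1f t2f tE), (transport (e := e) s1f s2f sE); split.
- exact: transport_morphism.
- exact: transport_morphism.
- by move=> [[U1 U2] UH]; apply: val_inj; rewrite /= !imgK.
- by move=> [[U1 U2] UH]; apply: val_inj; rewrite /= !imgK.
Qed.

End TwistedIsomorphisms.

(** * Directional derivatives of polynomials *)

Section DirectionalDerivative.
Local Open Scope ring_scope.
Variables (F : fieldType) (N : nat) (z : 'I_N -> F).
Implicit Types (w : 'I_N -> F) (p q : {mpoly F[N]}).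

(** Full row rank of a Jacobian at z will be proved as surjectivity of the map taking a direction
    [w] to the derivatives of the equations. *)
Definition dderiv w p : F := \sum_s w s * (p^`M(s)).@[z].

Lemma dderivD w p q : dderiv w (p + q) = dderiv w p + dderiv w q.
Proof.
rewrite -big_split; apply: eq_bigr => s _.
by rewrite mderivD mevalD mulrDr.
Qed.

Lemma dderivZ w c p : dderiv w (c *: p) = c * dderiv w p.
Proof.
rewrite mulr_sumr; apply: eq_bigr => s _.
by rewrite mderivZ mevalZ mulrCA.
Qed.

Lemma dderivB w p q : dderiv w (p - q) = dderiv w p - dderiv w q.
Proof. by rewrite -scaleN1r dderivD dderivZ mulN1r. Qed.

Lemma dderiv0 w : dderiv w 0 = 0.
Proof. by rewrite -[0 in LHS](scale0r 0) dderivZ mul0r. Qed.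

Lemma dderivM w p q :
  dderiv w (p * q) = dderiv w p * q.@[z] + p.@[z] * dderiv w q.
Proof.
rewrite mulr_suml mulr_sumr -big_split; apply: eq_bigr => s _ /=.
by rewrite mderivM mevalD !mevalM mulrDr mulrA [in X in _ + X = _]mulrCA.
Qed.

Lemma dderiv1 w : dderiv w 1 = 0.
Proof. by rewrite /dderiv big1 // => s _; rewrite mderivC meval0 mulr0. Qed.

Lemma dderiv_sum w (I : finType) (f : I -> {mpoly F[N]}) :
  dderiv w (\sum_i f i) = \sum_i dderiv w (f i).
Proof.
elim/big_rec2: _ => [|i x y _ <-]; first exact: dderiv0.
by rewrite dderivD.
Qed.

Lemma dderivX w s : dderiv w 'X_s = w s.
Proof.
rewrite /dderiv (bigD1 s) //= big1 ?addr0 => [|t ts].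
  rewrite mderivX mnm1E eqxx scale1r -{1}[U_(s)%MM]add0m addmK.
  by rewrite mpolyX0 meval1 mulr1.
by rewrite mderivX mnm1E eq_sym (negPf ts) scale0r meval0 mulr0.
Qed.

Lemma dderiv_addl w w' p :
  dderiv (fun s => w s + w' s) p = dderiv w p + dderiv w' p.
Proof. by rewrite -big_split; apply: eq_bigr => s _; rewrite mulrDl. Qed.

Lemma dderiv_prod0 w (I : finType) (f : I -> {mpoly F[N]}) :
  (forall i, dderiv w (f i) = 0) -> dderiv w (\prod_i f i) = 0.
Proof.
move=> f0; elim/big_rec: _ => [|i x _ x0]; first exact: dderiv1.
by rewrite dderivM f0 x0 mul0r mulr0 addr0.
Qed.

Lemma dderiv_exp0 w p k : dderiv w p = 0 -> dderiv w (p ^+ k) = 0.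
Proof.
move=> p0; elim: k => [|k IH]; first exact: dderiv1.
by rewrite exprS dderivM p0 IH mul0r mulr0 addr0.
Qed.

Lemma dderiv_det0 w k (A : 'M[{mpoly F[N]}]_k) :
  (forall i j, dderiv w (A i j) = 0) -> dderiv w (\det A) = 0.
Proof.
move=> A0; rewrite dderiv_sum big1 // => s _.
rewrite dderivM dderiv_exp0 ?dderiv_prod0 ?mul0r ?mulr0 ?addr0 //.
by rewrite -[-1]sub0r dderivB dderiv0 dderiv1 subr0.
Qed.

End DirectionalDerivative.

Lemma dhomog_det (F : fieldType) N k (A : 'M[{mpoly F[N]}]_k) :
  (forall i j, A i j \is 1.-homog) -> (\det A)%R \is k.-homog.
Proof.
move=> A1; apply: rpred_sum => s _; rewrite -signr_odd mulr_sign.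
have P1 : (\prod_i A i (s i))%R \is k.-homog.
  have := @dhomog_bigprod _ _ _ _ (fun=> 1%N) (fun i => A1 i (s i)).
  by rewrite sum1_card card_ord.
by case: ifP => // _; rewrite rpredN.
Qed.

(** * Affine charts of a Grassmannian: matrices that are the identity on chosen columns *)

Section AffineChart.
Local Open Scope ring_scope.
Variable F : fieldType.

(** The tuple for reading off an affine coordinate: on a matrix normalized at I, its minor is the
    entry (i, j). *)
Definition ffupd k d (I : {ffun 'I_k -> 'I_d}) i j : {ffun 'I_k -> 'I_d} :=
  [ffun l => if l == i then j else I l].

Lemma det_ffupd k d (I : {ffun 'I_k -> 'I_d}) (X : 'M[F]_(k, d)) i j :
  colsub I X = 1%:M -> \det (colsub (ffupd I i j) X) = X i j.
Proof.
move=> X1; have XE l l' : X l (I l') = (l == l')%:R.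
  by have := congr1 (fun M : 'M_k => M l l') X1; rewrite !mxE.
rewrite (expand_det_row _ i) (bigD1 i) //= big1 ?addr0 => [|l li].
  rewrite mxE ffunE eqxx /cofactor addnn -signr_odd odd_double expr0 mul1r.
  have -> : row' i (col' i (colsub (ffupd I i j) X)) = 1%:M.
    apply/matrixP => a b; rewrite !mxE ffunE eq_sym (negPf (neq_lift _ _)) XE.
    by rewrite (inj_eq lift_inj).
  by rewrite det1 mulr1.
by rewrite mxE ffunE (negPf li) XE eq_sym (negPf li) mul0r.
Qed.

Lemma colsub1_inj k d (I : {ffun 'I_k -> 'I_d}) (X : 'M[F]_(k, d)) :
  colsub I X = 1%:M -> injective I.
Proof.
move=> X1 i j Iij; have XE l l' : X l (I l') = (l == l')%:R.
  by have := congr1 (fun M : 'M_k => M l l') X1; rewrite !mxE.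
have := XE i j; rewrite -Iij XE eqxx; case: eqP => //= _ /eqP.
by rewrite mulr1n mulr0n oner_eq0.
Qed.

Definition chart_mx k d (I : {ffun 'I_k -> 'I_d}) (x : 'I_k -> 'I_d -> F) :=
  \matrix_(i < k, j < d) if j \in codom I then (j == I i)%:R else x i j.

Lemma colsub_chart_mx k d (I : {ffun 'I_k -> 'I_d}) x :
  injective I -> colsub I (chart_mx I x) = 1%:M.
Proof.
move=> Iinj; apply/matrixP => i j; rewrite !mxE codom_f (inj_eq Iinj).
by rewrite eq_sym.
Qed.

Lemma chart_mxE k d (I : {ffun 'I_k -> 'I_d}) (X : 'M[F]_(k, d)) x :
  colsub I X = 1%:M -> (forall i j, j \notin codom I -> x i j = X i j) ->
  chart_mx I x = X.
Proof.
move=> X1 xX; have Iinj := colsub1_inj X1.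
apply/matrixP => i j; rewrite mxE; case: ifP => [/codomP[l ->] | /negbT /xX //].
rewrite (inj_eq Iinj).
by have := congr1 (fun M : 'M_k => M i l) X1; rewrite !mxE eq_sym => ->.
Qed.

Lemma colsub_row_free k d (I : {ffun 'I_k -> 'I_d}) (X : 'M[F]_(k, d)) :
  colsub I X = 1%:M -> row_free X.
Proof.
move=> X1; apply: row_freeW => r x xX; rewrite -[x]mulmx1 -X1 mulmx_colsub xX.
by apply/matrixP => i j; rewrite !mxE.
Qed.

Lemma normalized_minor k d (I : {ffun 'I_k -> 'I_d}) (B : 'M[F]_(k, d)) :
  \det (colsub I B) != 0 ->
  exists2 X, B = colsub I B *m X & colsub I X = 1%:M.
Proof.
move=> B0; have Bu : colsub I B \in unitmx by rewrite unitmxE unitfE.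
exists (invmx (colsub I B) *m B); first by rewrite mulmxA mulmxV ?mul1mx.
by rewrite -mulmx_colsub mulVmx.
Qed.

End AffineChart.

(** * Homogeneous equations of the quiver Grassmannian in a chart, and their derivatives *)

Section QuiverChart.
Local Open Scope ring_scope.
Variables (F : fieldType) (n : nat) (Q : krep F n) (e : nat * nat).
Variables (I0 : {ffun 'I_e.1 -> 'I_(dim1 Q)}) (J0 : {ffun 'I_e.2 -> 'I_(dim2 Q)}).

Local Notation T := (coord_index e Q).
Local Notation N := #|{: T}|.

Definition pcoord (t : T) : {mpoly F[N]} := 'X_(enum_rank t).

Definition xidx i j : T := (ffupd I0 i j, J0).
Definition yidx i j : T := (I0, ffupd J0 i j).
Definition z0idx : T := (I0, J0).

(** Linear forms whose values at z are z_0 times the entries of the normalized matrix. *)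
Definition Xh : 'M[{mpoly F[N]}]_(e.1, dim1 Q) := \matrix_(i, j)
  if j \in codom I0 then if j == I0 i then pcoord z0idx else 0 else pcoord (xidx i j).
Definition Yh : 'M[{mpoly F[N]}]_(e.2, dim2 Q) := \matrix_(i, j)
  if j \in codom J0 then if j == J0 i then pcoord z0idx else 0 else pcoord (yidx i j).

(* Homogenized form of the expression of all Plucker-Segre coordinates as
   products of minors of the affine coordinates. *)
Definition graph_eq (t : T) : {mpoly F[N]} :=
  pcoord t * pcoord z0idx ^+ (e.1 + e.2)
  - pcoord z0idx * (\det (colsub t.1 Xh) * \det (colsub t.2 Yh)).

Definition YAh a i j : {mpoly F[N]} := \sum_l arr Q a l j *: Yh i l.

(** Homogenization of Y A = (Y A)_I X. As X is the identity on the columns I, this says that the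
    rows of Y A lie in the row space of X. *)
Definition subrep_eq a i j : {mpoly F[N]} :=
  YAh a i j * pcoord z0idx - \sum_l YAh a i (I0 l) * Xh l j.

(** The indices of z_0 and of the affine coordinates. Graph equations will be imposed only at the
    other indices, each of which they express through these. *)
Definition chart_idx (t : T) : bool :=
  [|| t == z0idx,
      [exists i, exists j, (j \notin codom I0) && (t == xidx i j)]
    | [exists i, exists j, (j \notin codom J0) && (t == yidx i j)]].

Lemma pcoord_homog t : pcoord t \is 1.-homog.
Proof. by rewrite dhomogX; apply/eqP; apply: mdeg1. Qed.

Lemma Xh_homog i j : Xh i j \is 1.-homog.
Proof. by rewrite mxE; do 2?case: ifP => _; rewrite ?pcoord_homog ?dhomog0. Qed.

Lemma Yh_homog i j : Yh i j \is 1.-homog.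
Proof. by rewrite mxE; do 2?case: ifP => _; rewrite ?pcoord_homog ?dhomog0. Qed.

Lemma graph_eq_homog t : graph_eq t \is (1 + (e.1 + e.2)).-homog.
Proof.
apply: rpredB; apply: dhomogM; rewrite ?pcoord_homog //.
  by have := dhomogMn (e.1 + e.2) (pcoord_homog z0idx); rewrite mul1n.
by apply: dhomogM; apply: dhomog_det => i j; rewrite mxE ?Xh_homog ?Yh_homog.
Qed.

Lemma YAh_homog a i j : YAh a i j \is 1.-homog.
Proof. by apply: rpred_sum => l _; apply: dhomogZ; apply: Yh_homog. Qed.

Lemma subrep_eq_homog a i j : subrep_eq a i j \is (1 + 1).-homog.
Proof.
apply: rpredB; first by apply: dhomogM; rewrite ?YAh_homog ?pcoord_homog.
by apply: rpred_sum => l _; apply: dhomogM; rewrite ?YAh_homog ?Xh_homog.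
Qed.

Section Evaluation.
Variable z : 'I_N -> F.
Let zc t := z (enum_rank t).
Let z0 := zc z0idx.
Hypothesis z0n0 : z0 != 0.

Definition affX :=
  chart_mx I0 (fun i j => z (enum_rank (xidx i j)) / z (enum_rank z0idx)).
Definition affY :=
  chart_mx J0 (fun i j => z (enum_rank (yidx i j)) / z (enum_rank z0idx)).

Lemma meval_pcoord t : (pcoord t).@[z] = zc t.
Proof. exact: mevalXU. Qed.

Lemma meval_Xh i j : (Xh i j).@[z] = z0 * affX i j.
Proof.
rewrite !mxE; case: ifP => _; last by rewrite meval_pcoord mulrC divfK.
by case: ifP => _; rewrite ?meval_pcoord ?mulr1 ?meval0 ?mulr0.
Qed.

Lemma meval_Yh i j : (Yh i j).@[z] = z0 * affY i j.
Proof.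
rewrite !mxE; case: ifP => _; last by rewrite meval_pcoord mulrC divfK.
by case: ifP => _; rewrite ?meval_pcoord ?mulr1 ?meval0 ?mulr0.
Qed.

Lemma meval_graph_eq t : (graph_eq t).@[z] = z0 ^+ (e.1 + e.2) *
  (zc t - z0 * (\det (colsub t.1 affX) * \det (colsub t.2 affY))).
Proof.
rewrite mevalB !mevalM rmorphXn /= !meval_pcoord -!det_map_mx.
have -> : map_mx (meval z) (colsub t.1 Xh) = z0 *: colsub t.1 affX.
  by apply/matrixP => i j; rewrite [LHS]mxE [X in meval z X]mxE meval_Xh
    [in RHS]mxE [in RHS]mxE.
have -> : map_mx (meval z) (colsub t.2 Yh) = z0 *: colsub t.2 affY.
  by apply/matrixP => i j; rewrite [LHS]mxE [X in meval z X]mxE meval_Yh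
    [in RHS]mxE [in RHS]mxE.
by rewrite !detZ exprD -/z0; ring.
Qed.

Lemma meval_YAh a i j : (YAh a i j).@[z] = z0 * (affY *m arr Q a) i j.
Proof.
rewrite raddf_sum [in RHS]mxE mulr_sumr; apply: eq_bigr => l _ /=.
by rewrite mevalZ meval_Yh mulrC mulrA.
Qed.

Lemma meval_subrep_eq a i j : (subrep_eq a i j).@[z] = z0 ^+ 2 *
  (affY *m arr Q a - colsub I0 (affY *m arr Q a) *m affX) i j.
Proof.
rewrite mevalB mevalM meval_YAh meval_pcoord -/z0.
rewrite [in RHS]mxE [X in _ * (_ + X)]mxE [X in _ * (_ - X)]mxE mulrBr.
congr (_ - _); first by ring.
rewrite raddf_sum mulr_sumr; apply: eq_bigr => l _ /=.
by rewrite mevalM meval_YAh meval_Xh [in RHS]mxE; ring.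
Qed.

End Evaluation.

Section PointsInChart.
Variables (z : 'I_N -> F) (y : quiverGr e Q) (c : F).
Hypothesis c0 : c != 0.
Hypothesis zy : forall t, z t = c * hcoord y t.
Hypothesis z0n0 : z (enum_rank z0idx) != 0.

Let B1 := basis_mx e.1 (val y).1.
Let B2 := basis_mx e.2 (val y).2.

Let zE t : z (enum_rank t) = c * (\det (colsub t.1 B1) * \det (colsub t.2 B2)).
Proof. by rewrite zy /= enum_rankK !pluckerE. Qed.

(** Dividing by the nonzero minors at [I0] and [J0] normalizes the basis matrices; their entries are
    then ratios of homogeneous coordinates. *)
Lemma chart_point : exists C1 C2, [/\ C1 \in unitmx /\ C2 \in unitmx,
  B1 = C1 *m affX z /\ B2 = C2 *m affY z,
  colsub I0 (affX z) = 1%:M, colsub J0 (affY z) = 1%:M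
  & z (enum_rank z0idx) = c * (\det C1 * \det C2)].
Proof.
have := z0n0; rewrite zE !mulf_eq0 /= negb_or => /andP[_].
rewrite negb_or => /andP[n1 n2].
have [X BX X1] := normalized_minor n1; have [Y BY Y1] := normalized_minor n2.
have XE : affX z = X.
  apply: chart_mxE => // i j _; rewrite !zE /= {1}BX det_colsub_mull det_ffupd //.
  by rewrite !invfM; field; rewrite c0 n1 n2.
have YE : affY z = Y.
  apply: chart_mxE => // i j _; rewrite !zE /= {1}BY det_colsub_mull det_ffupd //.
  by rewrite !invfM; field; rewrite c0 n1 n2.
exists (colsub I0 B1), (colsub J0 B2); rewrite XE YE !unitmxE !unitfE.
by split=> //; rewrite zE.
Qed.

Lemma chart_point_subrep a : affY z *m arr Q a = colsub I0 (affY z *m arr Q a) *m affX z.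
Proof.
have [C1 [C2 [[C1u C2u] [E1 E2] X1 Y1 _]]] := chart_point.
have /subrep_basisP[_ _ /(_ a)] := valP y; rewrite -/B1 -/B2 => sub.
have /submxP[D DE] : (affY z *m arr Q a <= affX z)%MS.
  have -> : affY z = invmx C2 *m B2 by rewrite E2 mulmxA mulVmx ?mul1mx.
  rewrite -mulmxA; apply: mulmx_sub; apply: submx_trans sub _.
  by rewrite E1 submxMl.
by rewrite DE -mulmx_colsub X1 mulmx1.
Qed.

Lemma chart_point_graph_eq t : (graph_eq t).@[z] = 0.
Proof.
have [C1 [C2 [[C1u C2u] [E1 E2] X1 Y1 zC]]] := chart_point.
rewrite meval_graph_eq // (zE t) zC E1 E2 !det_colsub_mull.
by rewrite [X in _ * X](_ : _ = 0) ?mulr0 //; ring.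
Qed.

Lemma chart_point_subrep_eq a i j : (subrep_eq a i j).@[z] = 0.
Proof. by rewrite meval_subrep_eq // -chart_point_subrep subrr mxE mulr0. Qed.

End PointsInChart.

(** The point is the pair of row spaces of [affX z] and [affY z]; the graph equations identify its
    coordinates with z up to a scalar. *)
Lemma chart_locus (z : 'I_N -> F) : injective I0 -> injective J0 ->
  z (enum_rank z0idx) != 0 ->
  (forall t, ~~ chart_idx t -> (graph_eq t).@[z] = 0) ->
  (forall a i j, j \notin codom I0 -> (subrep_eq a i j).@[z] = 0) ->
  exists y : quiverGr e Q, exists2 c, c != 0 & forall t, z t = c * hcoord y t.
Proof.
move=> Iinj Jinj zn0 zG zS; set z0 := z (enum_rank z0idx).
have X1 : colsub I0 (affX z) = 1%:M by apply: colsub_chart_mx.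
have Y1 : colsub J0 (affY z) = 1%:M by apply: colsub_chart_mx.
have zE t : z (enum_rank t) =
    z0 * (\det (colsub t.1 (affX z)) * \det (colsub t.2 (affY z))).
  have [tS | tS] := boolP (chart_idx t); last first.
    have /eqP := zG t tS; rewrite meval_graph_eq // mulf_eq0 expf_eq0 (negPf zn0).
    by rewrite andbF /= subr_eq0 => /eqP.
  case/or3P: tS => [/eqP -> | /existsP[i /existsP[j /andP[jn /eqP ->]]]
                   | /existsP[i /existsP[j /andP[jn /eqP ->]]]] /=.
  - by rewrite X1 Y1 !det1 !mulr1.
  - by rewrite Y1 det1 mulr1 det_ffupd // mxE (negPf jn) mulrC divfK.
  - by rewrite X1 det1 mul1r det_ffupd // mxE (negPf jn) mulrC divfK.
have sub a : affY z *m arr Q a = colsub I0 (affY z *m arr Q a) *m affX z.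
  apply/eqP; rewrite -subr_eq0; apply/eqP/matrixP => i j; rewrite [RHS]mxE.
  (* At a column of [I0] both sides agree because [affX z] is the identity there. *)
  have [/codomP[l ->] | jn] := boolP (j \in codom I0).
    set D := _ - _; have -> : D i (I0 l) = colsub I0 D i l by rewrite [RHS]mxE.
    have -> : colsub I0 D = 0; last by rewrite mxE.
    apply/matrixP => a' b'; rewrite mxE /D.
    rewrite mxE [X in _ + X]mxE; set E := colsub I0 (_ *m _).
    have -> : (E *m affX z) a' (I0 b') = (E *m colsub I0 (affX z)) a' b'.
      by rewrite mulmx_colsub [RHS]mxE.
    by rewrite X1 mulmx1 [E _ _]mxE subrr mxE.
  have /eqP := zS a i j jn; rewrite meval_subrep_eq // mulf_eq0 expf_eq0 (negPf zn0).
  by rewrite andbF /= => /eqP.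
have Xf := colsub_row_free X1; have Yf := colsub_row_free Y1.
have [C1 C1u E1] := basis_row_vspace Xf; have [C2 C2u E2] := basis_row_vspace Yf.
have UH : subrep_pred e (row_vspace (affX z), row_vspace (affY z)).
  apply/subrep_basisP; split; rewrite /= ?dim_row_vspace // => a.
  rewrite E1 E2 -mulmxA sub mulmxA; apply: submx_trans (submxMl _ (affX z)) _.
  by rewrite eqmxMfull ?row_full_unit.
rewrite unitmxE unitfE in C1u; rewrite unitmxE unitfE in C2u.
exists (exist (fun U => subrep_pred e U) _ UH), (z0 / (\det C1 * \det C2)).
  by rewrite mulf_neq0 // invr_neq0 // mulf_neq0.
move=> t; rewrite -[t in LHS]enum_valK zE /= !pluckerE E1 E2 !det_colsub_mull.
by field; rewrite C1u C2u.
Qed.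

Section Jacobian.
Variables (z : 'I_N -> F).
Let z0 := z (enum_rank z0idx).
Hypothesis z0n0 : z0 != 0.
Let D (w : T -> F) := dderiv z (fun s => w (enum_val s)).

Let D_pcoord w t : D w (pcoord t) = w t.
Proof. by rewrite /D dderivX enum_rankK. Qed.

Section Tangent.
Variables (w : T -> F) (dX : 'M[F]_(e.1, dim1 Q)) (dY : 'M[F]_(e.2, dim2 Q)).
Hypotheses (w0 : w z0idx = 0).
Hypotheses (wX : forall i j, j \notin codom I0 -> w (xidx i j) = dX i j).
Hypotheses (wY : forall i j, j \notin codom J0 -> w (yidx i j) = dY i j).
Hypotheses (dX0 : colsub I0 dX = 0) (dY0 : colsub J0 dY = 0).

Lemma dderiv_Xh i j : D w (Xh i j) = dX i j.
Proof.
rewrite mxE; case: ifP => [/codomP[l ->] | /negbT jn]; last by rewrite D_pcoord wX.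
have := congr1 (fun M : 'M_(e.1) => M i l) dX0; rewrite !mxE => ->.
by case: ifP => _; rewrite ?D_pcoord // /D dderiv0.
Qed.

Lemma dderiv_Yh i j : D w (Yh i j) = dY i j.
Proof.
rewrite mxE; case: ifP => [/codomP[l ->] | /negbT jn]; last by rewrite D_pcoord wY.
have := congr1 (fun M : 'M_(e.2) => M i l) dY0; rewrite !mxE => ->.
by case: ifP => _; rewrite ?D_pcoord // /D dderiv0.
Qed.

Lemma dderiv_YAh a i j : D w (YAh a i j) = (dY *m arr Q a) i j.
Proof.
rewrite /D dderiv_sum [RHS]mxE; apply: eq_bigr => l _.
by rewrite dderivZ [dderiv _ _ _]dderiv_Yh mulrC.
Qed.

Lemma dderiv_subrep_eq a i j : D w (subrep_eq a i j) = z0 *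
  (dY *m arr Q a - colsub I0 (dY *m arr Q a) *m affX z
   - colsub I0 (affY z *m arr Q a) *m dX) i j.
Proof.
rewrite /D dderivB dderivM [dderiv _ _ (YAh _ _ _)]dderiv_YAh.
rewrite [dderiv _ _ (pcoord _)]D_pcoord w0 mulr0 addr0 meval_pcoord -/z0.
rewrite dderiv_sum; under eq_bigr do
  rewrite dderivM [dderiv _ _ (YAh _ _ _)]dderiv_YAh [dderiv _ _ (Xh _ _)]dderiv_Xh
    meval_Xh // meval_YAh // -/z0.
rewrite big_split /= [in RHS]mxE [X in _ * (X + _)]mxE.
rewrite [X in _ * (_ + X + _)]mxE [X in _ * (_ - X + _)]mxE.
rewrite [X in _ * (_ + X)]mxE [X in _ * (_ - X)]mxE.
rewrite !mulrBr opprD addrA !mulr_sumr; congr (_ - _ - _); first exact: mulrC.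
  by apply: eq_bigr => l _; rewrite [in RHS]mxE; ring.
by apply: eq_bigr => l _; rewrite [in RHS]mxE; ring.
Qed.

End Tangent.

(** A direction without chart components moves each graph equation by its own component only, and no
    subrepresentation equation: the Jacobian is block triangular with an invertible diagonal
    block. *)
Lemma dderiv_off_chart (w : T -> F) : (forall t, chart_idx t -> w t = 0) ->
  (forall t, D w (graph_eq t) = z0 ^+ (e.1 + e.2) * w t) /\
  (forall a i j, D w (subrep_eq a i j) = 0).
Proof.
move=> w0.
have w00 : w z0idx = 0 by apply: w0; rewrite /chart_idx eqxx.
have wX i j : j \notin codom I0 -> w (xidx i j) = (0 : 'M_(_, _)) i j.
  move=> jn; rewrite mxE; apply: w0; apply/or3P; apply: Or32.
  by apply/existsP; exists i; apply/existsP; exists j; rewrite jn eqxx.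
have wY i j : j \notin codom J0 -> w (yidx i j) = (0 : 'M_(_, _)) i j.
  move=> jn; rewrite mxE; apply: w0; apply/or3P; apply: Or33.
  by apply/existsP; exists i; apply/existsP; exists j; rewrite jn eqxx.
have c0 k d (I : 'I_k -> 'I_d) l : colsub I (0 : 'M[F]_(l, d)) = 0.
  by apply/matrixP => i j; rewrite !mxE.
split=> [t | a i j].
  rewrite /D dderivB !dderivM [dderiv _ _ (pcoord _)]D_pcoord dderiv_exp0; last first.
    by rewrite [LHS]D_pcoord.
  rewrite [dderiv _ _ (pcoord z0idx)]D_pcoord w00 !dderiv_det0.
  - by rewrite !(mulr0, mul0r, addr0, subr0) rmorphXn /= meval_pcoord mulrC.
  - by move=> i j; rewrite mxE [LHS](dderiv_Yh w00 wY) ?c0 ?mxE.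
  - by move=> i j; rewrite mxE [LHS](dderiv_Xh w00 wX) ?c0 ?mxE.
rewrite (dderiv_subrep_eq w00 wX wY) ?c0 // !mul0mx c0 mul0mx mulmx0 !subr0.
by rewrite mxE mulr0.
Qed.

Lemma tangent_direction (dX : 'M[F]_(e.1, dim1 Q)) (dY : 'M[F]_(e.2, dim2 Q)) :
  exists w : T -> F, [/\ w z0idx = 0,
    forall i j, j \notin codom I0 -> w (xidx i j) = dX i j
  & forall i j, j \notin codom J0 -> w (yidx i j) = dY i j].
Proof.
have upd k d (I : {ffun 'I_k -> 'I_d}) i j : j \notin codom I ->
    [pick l | ffupd I i j l != I l] = Some i /\ ffupd I i j i = j.
  move=> jn; have E : ffupd I i j i = j by rewrite ffunE eqxx.
  split=> //; case: pickP => [l | /(_ i)]; rewrite ffunE ?eqxx.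
    by case: (l =P i) => [-> // | _]; rewrite eqxx.
  by move=> /negbFE/eqP jI; rewrite jI codom_f in jn.
have updn k d (I : {ffun 'I_k -> 'I_d}) i j : j \notin codom I -> ffupd I i j != I.
  move=> jn; apply/eqP => /(congr1 (fun f : {ffun _} => f i)); rewrite ffunE eqxx => jI.
  by rewrite jI codom_f in jn.
(* The row i of [xidx i j] or [yidx i j] is recovered as the position where the tuple differs from
   [I0] or [J0], and the column j as its value there. *)
exists (fun t : T => if t.2 == J0 then
    if [pick l | t.1 l != I0 l] is Some i then dX i (t.1 i) else 0
  else if [pick l | t.2 l != J0 l] is Some i then dY i (t.2 i) else 0).
split=> /=.
- by rewrite eqxx; case: pickP => // i; rewrite eqxx.
- by move=> i j jn; rewrite eqxx; have [-> ->] := upd _ _ I0 i j jn.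
- move=> i j jn; rewrite (negPf (updn _ _ _ _ _ jn)).
  by have [-> ->] := upd _ _ J0 i j jn.
Qed.

End Jacobian.

End QuiverChart.

(** * Smoothness from the vanishing of Ext^1 on proper subrepresentations *)

Section Smoothness.
Local Open Scope ring_scope.
Variables (F : fieldType) (n : nat).

Definition subreps_unobstructed (Q : krep F n) : Prop :=
  forall (U : krep F n) (i : vmaps U Q),
    i \in khom U Q -> row_free i.1 -> row_free i.2 ->
    (row_full i.1 /\ row_full i.2) \/ cocycles_trivial U Q.

(** Solves the linearized subrepresentation equations at U = (X, Y). A solution of the cocycle
    equation for U and Q is corrected by multiples of X and Y so that it vanishes on the chart
    columns. *)
Lemma unobstructed_tangent (Q : krep F n) k1 k2
    (I : 'I_k1 -> 'I_(dim1 Q)) (J : 'I_k2 -> 'I_(dim2 Q))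
    (X : 'M[F]_(k1, dim1 Q)) (Y : 'M[F]_(k2, dim2 Q))
    (tau : 'I_n -> 'M[F]_(k2, dim1 Q)) :
  subreps_unobstructed Q -> row_free X -> row_free Y ->
  colsub I X = 1%:M -> colsub J Y = 1%:M ->
  (forall a, Y *m arr Q a = colsub I (Y *m arr Q a) *m X) ->
  (forall a, colsub I (tau a) = 0) ->
  exists dX dY, [/\ colsub I dX = 0, colsub J dY = 0 & forall a,
    dY *m arr Q a - colsub I (dY *m arr Q a) *m X
    - colsub I (Y *m arr Q a) *m dX = tau a].
Proof.
move=> unob Xf Yf X1 Y1 YX tau0.
have csB r d k (K : 'I_k -> 'I_d) (A B : 'M[F]_(r, d)) :
    colsub K (A - B) = colsub K A - colsub K B.
  by apply/matrixP => i j; rewrite !mxE.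
pose U : krep F n := KRep (fun a => colsub I (Y *m arr Q a)).
have [] := unob U (X, Y) _ Xf Yf; first by apply/mem_khom => a /=; rewrite -YX.
  move=> [/= XF _]; exists 0, 0.
  have cs0 r d k (K : 'I_k -> 'I_d) : colsub K (0 : 'M[F]_(r, d)) = 0.
    by apply/matrixP => i j; rewrite !mxE.
  rewrite !cs0; split=> // a; rewrite mul0mx cs0 mul0mx mulmx0 !subr0.
  (* When U = Q, [tau a] is a multiple of X; vanishing on the columns I forces it to be zero. *)
  have [x xE] := row_full_lift (tau a) XF.
  suff x0 : x = 0 by rewrite xE x0 mul0mx.
  rewrite -[x]mulmx1 -X1 mulmx_colsub -(tau0 a); congr (colsub I _).
  by rewrite xE.
move=> /(_ tau)[[f1 f2] fE]; rewrite /intertwine /= in fE.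
exists (colsub I f1 *m X - f1), (colsub J f2 *m Y - f2); split.
- by rewrite csB -mulmx_colsub X1 mulmx1 subrr.
- by rewrite csB -mulmx_colsub Y1 mulmx1 subrr.
move=> a; have := YX a; have := tau0 a; rewrite {}fE /=.
set A := arr Q a; move: (colsub I (Y *m A)) => al E0 YA.
have csM r k (C : 'M[F]_(r, k)) (Z : 'M[F]_(k, dim1 Q)) :
    colsub I (C *m Z) = C *m colsub I Z by rewrite mulmx_colsub.
have {}E0 : colsub I (f2 *m A) = al *m colsub I f1.
  by apply/eqP; rewrite eq_sym -subr_eq0 -csM -csB E0.
have dYA : (colsub J f2 *m Y - f2) *m A = colsub J f2 *m al *m X - f2 *m A.
  by rewrite mulmxBl -[_ *m Y *m A]mulmxA YA mulmxA.
rewrite dYA csB csM X1 mulmx1 E0 mulmxBl mulmxBr mulmxA.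
by apply/matrixP => i j; move: (al *m f1) (f2 *m A) => p q; rewrite !mxE; ring.
Qed.

Lemma unobstructed_smooth (Q : krep F n) (e : nat * nat) :
  subreps_unobstructed Q -> smooth (quiverGr e Q).
Proof.
move=> unob x; have /subrep_basisP[d1 d2 _] := valP x.
have [I0 I0n] := row_free_minor (basis_mx_free d1).
have [J0 J0n] := row_free_minor (basis_mx_free d2).
pose z : 'I_#|{: coord_index e Q}| -> F := hcoord x.
have z1 t : z t = 1 * hcoord x t by rewrite mul1r.
have z0n0 : z (enum_rank (z0idx I0 J0)) != 0.
  by rewrite /z /= enum_rankK !pluckerE mulf_neq0.
have [_ [_ [_ _ X1 Y1 _]]] := chart_point (oner_neq0 F) z1 z0n0.
have YX := chart_point_subrep (oner_neq0 F) z1 z0n0.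
have Iinj := colsub1_inj X1; have Jinj := colsub1_inj Y1.
pose S := chart_idx I0 J0.
(* Graph equations off the chart and subrepresentation equations away from the columns [I0]: the
   remaining ones hold identically and would spoil the rank. *)
pose E : finType := ({t : coord_index e Q | ~~ S t} +
  {s : 'I_n * 'I_e.2 * 'I_(dim1 Q) | s.2 \notin codom I0})%type.
pose f (i : E) := match i with
  | inl t => graph_eq I0 J0 (val t)
  | inr s => subrep_eq I0 J0 (val s).1.1 (val s).1.2 (val s).2 end.
have point_eqs (y : quiverGr e Q) c z' : c != 0 ->
    z' (enum_rank (z0idx I0 J0)) != 0 ->
    (forall t, z' t = c * hcoord y t) -> forall i, (f i).@[z'] = 0.
  move=> c0 z'0 z'E [t | s] /=; first exact: (chart_point_graph_eq c0 z'E z'0).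
  exact: (chart_point_subrep_eq c0 z'E z'0).
(* First [w0] meets the prescribed derivatives of the subrepresentation equations, using
   [unobstructed_tangent]; then [w1], supported off the chart, corrects the graph equations without
   disturbing them. *)
have surj (b : E -> F) : exists w, forall i, dderiv z w (f i) = b i.
  pose z0 := z (enum_rank (z0idx I0 J0)).
  pose tau a : 'M[F]_(e.2, dim1 Q) := \matrix_(i, j)
    (if insub (a, i, j) is Some s then z0^-1 * b (inr s) else 0).
  have tau0 a : colsub I0 (tau a) = 0.
    apply/matrixP => i j; rewrite !mxE insubF //=.
    by rewrite codom_f.
  have [dX [dY [dX0 dY0 dE]]] :=
    unobstructed_tangent unob (colsub_row_free X1) (colsub_row_free Y1) X1 Y1 YX tau0.
  have [w0 [w00 wX wY]] := tangent_direction I0 J0 dX dY.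
  pose D (w : coord_index e Q -> F) := dderiv z (fun s => w (enum_val s)).
  pose w1 t := if insub t is Some t' then
    (b (inl t') - D w0 (graph_eq I0 J0 t)) / z0 ^+ (e.1 + e.2) else 0.
  have w1S t : chart_idx I0 J0 t -> w1 t = 0.
    by move=> tS; rewrite /w1 insubF //; apply/negbF.
  have [Dg Ds] := dderiv_off_chart z0n0 w1S.
  exists (fun s => w0 (enum_val s) + w1 (enum_val s)) => i.
  rewrite dderiv_addl; case: i => [t | s] /=.
    rewrite Dg /w1 valK -/z0 mulrC divfK ?expf_neq0 //.
    by rewrite addrC subrK.
  rewrite Ds addr0 (dderiv_subrep_eq z0n0 w00 wX wY dX0 dY0) dE mxE -/z0.
  case: s => -[[a i] j] sP /=; rewrite (insubT (fun s => s.2 \notin codom I0) sP) /=.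
  by rewrite mulVKf.
exists #|{: E}|, (fun i => f (enum_val i)), (pcoord (z0idx I0 J0)); split.
- move=> i; case: (enum_val i) => [t | s] /=; eexists.
    exact: graph_eq_homog.
  exact: subrep_eq_homog.
- split; first by exists 1%N; apply: pcoord_homog.
  by rewrite meval_pcoord.
- move=> z' _; rewrite meval_pcoord => z'0; split=> [z'f | [y [c c0 z'E]] i].
    apply: (chart_locus Iinj Jinj z'0) => [t tS | a i j jn].
      have := z'f (enum_rank (inl (exist (fun t => ~~ S t) t tS) : E)).
      by rewrite enum_rankK.
    have := z'f (enum_rank (inr (exist (fun s : 'I_n * 'I_e.2 * 'I_(dim1 Q) =>
      s.2 \notin codom I0) (a, i, j) jn) : E)).
    by rewrite enum_rankK.
  exact: point_eqs z'E _.
apply/eqP/row_freeP.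
(* Directions dual to the equations form a right inverse of the Jacobian. *)
have /fin_all_exists[W WE] (i : 'I_#|{: E}|) := surj (fun e' => (e' == enum_val i)%:R).
exists (\matrix_(j, i) W i j); apply/matrixP => i i'; rewrite !mxE.
have := WE i' (enum_val i); rewrite (inj_eq enum_val_inj) => <-.
by apply: eq_bigr => j _; rewrite !mxE mulrC.
Qed.

End Smoothness.

(** * Quiver Grassmannians of truncated preprojectives *)

Theorem theorem4p12 (R : realType) (n m : nat) (hn : 3 <= n) (hm : 1 <= m)
  (e : nat * nat) (P P' : krep R[i] n)
  (hP : preprojective m P) (hP' : preprojective m.+1 P') :
  (forall (V : {vspace vmaps P P'}) (Q : krep R[i] n),
     proper_subspace V -> truncated V Q -> smooth (quiverGr e Q)) /\
  (forall (V W : {vspace vmaps P P'}) (Q Q' : krep R[i] n),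
     proper_subspace V -> proper_subspace W -> \dim V = \dim W ->
     truncated V Q -> truncated W Q' ->
     var_iso (quiverGr e Q) (quiverGr e Q')).
Proof.
(* After the shift P is P_{m+1}, which is m reflections away from P_1. *)
case: m hm hP hP' => // m _ hP hP'.
have n1 : 1 < n by apply: leq_trans hn.
split=> [V Q pV tV | V W Q Q' pV pW dVW tV tW].
  have [_ cQ] := truncated_chain n1 hP hP' pV tV.
  apply: unobstructed_smooth => U i iH i1 i2.
  exact: reflection_chain_sub_ext cQ iH i1 i2.
have [_ cQ] := truncated_chain n1 hP hP' pV tV.
have [_ cQ'] := truncated_chain n1 hP hP' pW tW.
rewrite dVW in cQ; apply: twisted_iso_var_iso.
exact: reflection_chain_twisted_iso cQ cQ'.
Qed.
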